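(* For every $\gamma>0$ there exists a constant $C$ such that for every function $p=p(n)\in(0,1]$ the random graph $\Gamma=G(n,p)$ asymptotically almost surely has the following property: every triangle-free spanning subgraph $H\subseteq\Gamma$ with minimum degree $\delta(H)\ge\left(\frac25+\gamma\right)pn$ can be made bipartite by removing at most $$\min\left(Cp^{-1}n,\ \left(\tfrac14+\gamma\right)pn^2\right)$$ edges.
   Context: $G(n,p)$ is the binomial random graph on vertex set $[n]=\{1,\dots,n\}$, in which each pair of vertices is an edge independently with probability $p$. ''Asymptotically almost surely'' means with probability tending to $1$ as $n\to\infty$. A spanning subgraph of $\Gamma$ is a subgraph with the same vertex set as $\Gamma$. *)

(* Defs.v *)
From HB Require Import structures.
From mathcomp Require Import all_boot all_order all_algebra.
From mathcomp Require Import all_classical all_reals all_analysis.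

Set Implicit Arguments.
Unset Strict Implicit.
Unset Printing Implicit Defensive.

Import Order.TTheory GRing.Theory Num.Theory.
Import numFieldNormedType.Exports.

Local Open Scope ring_scope.

(* A finite simple graph with vertex type T is represented by its edge set
   E : {set {set T}}, subject to E \subset pairs T.  Subsets of a graph are
   therefore exactly its spanning subgraphs. *)
Definition pairs (T : finType) : {set {set T}} := [set e : {set T} | #|e| == 2%N].

Definition adj (T : finType) (E : {set {set T}}) (u v : T) : bool :=
  [set u; v] \in E.

Definition degree (T : finType) (E : {set {set T}}) (v : T) : nat :=
  #|[set u | adj E v u]|.

(* The default value #|T| exceeds every degree of a simple graph, so it is
   only attained when T is empty. *)
Definition min_degree (T : finType) (E : {set {set T}}) : nat :=
  \big[minn/#|T|]_(v : T) degree E v.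

Definition triangle_free (T : finType) (E : {set {set T}}) : Prop :=
  forall u v w : T, ~ [/\ adj E u v, adj E v w & adj E u w].

Definition bipartite (T : finType) (E : {set {set T}}) : Prop :=
  exists A : {set T}, forall u v : T, adj E u v -> (u \in A) != (v \in A).

(* The probability that G(n, p) is the graph E. *)
Definition gnp_weight (R : realType) (n : nat) (p : R)
    (E : {set {set 'I_n}}) : R :=
  \prod_(e in pairs 'I_n) (if e \in E then p else 1 - p).

Definition gnp_prob (R : realType) (n : nat) (p : R)
    (Q : {set {set 'I_n}} -> Prop) : R :=
  \sum_(E in powerset (pairs 'I_n) | `[< Q E >]) gnp_weight p E.

Definition aas (R : realType) (p : nat -> R)
    (Q : forall n : nat, {set {set 'I_n}} -> Prop) : Prop :=
  ((fun n : nat => gnp_prob (p n) (@Q n)) @ \oo --> (1 : R))%classic.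

(* Main.v *)
(* If p^2 n is bounded, take for F the edges inside the two sides of a maximum
   cut of H: this is at most half of e(G), and e(G) is concentrated (if even p n
   tends to 0, then G has fewer than n/2 edges and no H has positive minimum
   degree).

   If p^2 n is large, no regularity lemma is needed.  The only property of G used is
   an upper tail bound for edges of G avoiding a small set U, uniform over all
   families of vertex sets determined by the edges of H that meet U.
   (1) H is nearly bipartite.  Choose U small such that adding few more vertices
   to U hardly increases the set S of pairs with a common H-neighbour in U.  Then
   for almost every x almost all pairs in N(x) x N(x) lie in S, while S misses the
   edges of H.  So the dense sets S(x) have density between 2/5 and 3/5, overlap in
   more than 2/5 at distance two in H and in less than 1/5 along edges of H; after
   one improvement step they are even disjoint along edges, and the proof of the
   theorem of Andrasfai, Erdos and Sos can be carried out with these sets.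
   (2) In a maximum cut X, Y with o(p n^2) inner edges, suppose more than C n / p
   edges of H join vertices of X, one end of each having few neighbours in X.
   Pruning and sampling give a set U in X and many vertices v with C / p
   neighbours in U each.  The neighbours in Y of those form a dense set T(v) which H
   avoids at v, and T(v) is so large that G has too few edges from v to Y \ T(v). *)

Require Import Defs.
From HB Require Import structures.
From mathcomp Require Import all_boot all_order all_algebra.
From mathcomp Require Import all_classical all_reals all_analysis.
From mathcomp Require Import ring lra zify fintype finset.

Set Implicit Arguments.
Unset Strict Implicit.
Unset Printing Implicit Defensive.

Import Order.TTheory GRing.Theory Num.Theory.
Import numFieldNormedType.Exports.

Local Open Scope ring_scope.

(** * Degrees and edge counts *)

Section Counting.
Variable V : finType.
Implicit Types (r s : rel V) (x y : V) (A B X Y : {set V}).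

Definition rdeg r x B : nat := #|[set y in B | r x y]|.

Definition ec r A B : nat := \sum_(x in A) rdeg r x B.

Lemma card_setU_le A B : (#|A :|: B| <= #|A| + #|B|)%N.
Proof. by rewrite cardsU leq_subr. Qed.

Lemma rdeg0 r x B : (forall y, y \in B -> ~~ r x y) -> rdeg r x B = 0%N.
Proof.
move=> rB; apply/eqP; rewrite cards_eq0; apply/eqP/setP => y; rewrite !inE.
by apply/negP => /andP[/rB /negPf ->].
Qed.

Lemma rdegS r x A B : A \subset B -> (rdeg r x A <= rdeg r x B)%N.
Proof.
move=> /subsetP AB; apply: subset_leq_card; apply/subsetP => y.
by rewrite !inE => /andP[/AB -> ->].
Qed.

Lemma rdeg_le r s x B :
  (forall y, y \in B -> r x y -> s x y) -> (rdeg r x B <= rdeg s x B)%N.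
Proof.
move=> rs; apply: subset_leq_card; apply/subsetP => y.
by rewrite !inE => /andP[yB ry]; rewrite yB rs.
Qed.

Lemma rdeg_sub r x A B :
  (forall y, y \in A -> r x y -> y \in B) -> (rdeg r x A <= rdeg r x B)%N.
Proof.
move=> rs; apply: subset_leq_card; apply/subsetP => y.
by rewrite !inE => /andP[yB ry]; rewrite ry (rs _ yB ry).
Qed.

Lemma rdegID r x A B : rdeg r x A = (rdeg r x (A :&: B) + rdeg r x (A :\: B))%N.
Proof.
rewrite /rdeg -[LHS](cardsID B); congr (_ + _)%N; congr #|pred_of_set _|;
  by apply/setP => y; rewrite !inE; do ?case: (y \in _) => //=; rewrite ?andbT ?andbF.
Qed.

Lemma rdegC r x B : rdeg r x setT = (rdeg r x B + rdeg r x (~: B))%N.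
Proof. by rewrite (rdegID r x setT B) setTI setTD. Qed.

Lemma rdegU r x A B : (rdeg r x (A :|: B) <= rdeg r x A + rdeg r x B)%N.
Proof.
rewrite (rdegID r x (A :|: B) A) leq_add ?rdegS ?subsetIr //.
by apply/subsetP => y; rewrite !inE => /andP[/negPf ->].
Qed.

Lemma rdeg_mem r x B : (0 < rdeg r x B)%N -> exists2 y, y \in B & r x y.
Proof. by rewrite card_gt0 => /set0Pn[y]; rewrite inE => /andP[yB ry]; exists y. Qed.

Lemma ec_exchange r A B :
  ec r A B = (\sum_(y in B) #|[set x in A | r x y]|)%N.
Proof.
rewrite /ec /rdeg; under eq_bigr => x _ do rewrite -sum1dep_card.
under [RHS]eq_bigr => x _ do rewrite -sum1dep_card.
rewrite (exchange_big_dep (mem B)) /=; last by move=> x y _ /andP[].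
by apply: eq_bigr => y yB; apply: eq_bigl => x; rewrite yB.
Qed.

Lemma ec_sym r A B : symmetric r -> ec r A B = ec r B A.
Proof.
move=> rsym; rewrite ec_exchange; apply: eq_bigr => y _; rewrite /rdeg.
by congr #|pred_of_set _|; apply/setP => x; rewrite !inE rsym.
Qed.

Lemma ec_le r s A B : (forall x y, r x y -> s x y) -> (ec r A B <= ec s A B)%N.
Proof. by move=> rs; apply: leq_sum => x _; apply: rdeg_le => y _; apply: rs. Qed.

Lemma ecS r A B X Y : A \subset X -> B \subset Y -> (ec r A B <= ec r X Y)%N.
Proof.
move=> AX BY; rewrite /ec [leqRHS](big_setID A) /= (setIidPr AX).
apply: leq_trans (leq_addr _ _); apply: leq_sum => x _; exact: rdegS.
Qed.

Lemma ec_or r s t A B :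
  (forall x y, r x y -> s x y || t x y) -> (ec r A B <= ec s A B + ec t A B)%N.
Proof.
move=> rst; rewrite /ec -big_split; apply: leq_sum => x _ /=.
apply: leq_trans (card_setU_le _ _); apply: subset_leq_card; apply/subsetP => y.
by rewrite !inE => /andP[-> /rst].
Qed.

Lemma ecID r A B X : ec r A X = (ec r (A :&: B) X + ec r (A :\: B) X)%N.
Proof. exact: big_setID. Qed.

Lemma ec_ge (R : realFieldType) r A B (k : R) :
  (forall x, x \in A -> k <= (rdeg r x B)%:R) -> #|A|%:R * k <= (ec r A B)%:R.
Proof.
move=> kr; rewrite natr_sum mulr_natl -sumr_const; exact: ler_sum.
Qed.

Lemma card_inter_le A B X : (#|A :&: B| + #|A :&: X| <= #|A| + #|B :&: X|)%N.
Proof.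
rewrite -cardsUI -setIUr; apply: leq_add; apply: subset_leq_card.
  exact: subsetIl.
by apply/subsetP => y; rewrite !inE => /andP[/andP[_ ->] /andP[_ ->]].
Qed.

Lemma exists_subset_card A k : (k <= #|A|)%N -> exists2 B : {set V}, B \subset A & #|B| = k.
Proof.
move=> kA; exists [set x in take k (enum A)].
  by apply/subsetP => x; rewrite inE => /mem_take; rewrite mem_enum.
rewrite cardsE (card_uniqP _) ?take_uniq ?enum_uniq // size_take -cardE.
by case: ltngtP kA.
Qed.

End Counting.

(** * One-sided regularity and saturated vertex sets *)

Section UpperRegular.
Variables (R : realFieldType) (V : finType).
Implicit Types (g h : rel V) (A B T U W : {set V}).
Local Notation n := (#|V|%:R : R).

(** The additive term [C * n] is below [eps * (p * n) * #|A|] once [#|A|] reaches C / (eps p), so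
    the bound is useful for sets [A] far below linear size. *)
Definition upper_regular g (p eps C : R) := forall A B,
  (ec g A B)%:R <= p * #|A|%:R * #|B|%:R + eps * (p * n) * #|A|%:R + C * n.

Definition via h U z : {set V} := [set y | [exists u in U, h u z && h u y]].

Lemma card_le_n (A : {set V}) : #|A|%:R <= n.
Proof. by rewrite ler_nat max_card. Qed.

Lemma viaP h U y z : reflect (exists2 u, u \in U & h u z && h u y) (y \in via h U z).
Proof. rewrite inE; exact: exists_inP. Qed.

Lemma viaU h U W z : via h U z \subset via h (U :|: W) z.
Proof.
apply/subsetP => y /viaP[u uU hu]; apply/viaP; exists u => //.
by rewrite inE uU.
Qed.

Lemma via0 h z : via h set0 z = set0.
Proof. by apply/setP => y; rewrite [RHS]inE; apply/viaP => -[u]; rewrite inE. Qed.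

(** Take [U] maximising the total size of the sets [via h U z] minus a charge of n / c per vertex.
    Comparison with the empty set bounds [#|U|], because the total never exceeds n ^ 2; comparison
    with [U :|: W] bounds the gain. *)
Lemma exists_saturating h (c : R) : 0 < c ->
  exists U, #|U|%:R <= c * n /\
   forall W, (\sum_z #|via h (U :|: W) z :\: via h U z|)%:R <= #|W|%:R * n / c.
Proof.
move=> c0.
pose f U : R := (\sum_z #|via h U z|)%:R - #|U|%:R * n / c.
have [U _ maxU] := @Order.TotalTheory.arg_maxP _ R _ (set0 : {set V}) xpredT f isT.
have n0 : 0 <= n by rewrite ler0n.
have c1 : 0 < c^-1 by rewrite invr_gt0.
exists U; split.
  have := maxU set0 isT; rewrite /f cards0 !mul0r subr0.
  rewrite /= [X in X%:R <= _ -> _]big1 => [|z _]; last by rewrite via0 cards0.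
  rewrite subr_ge0 => H0.
  have H1 : #|U|%:R * n / c <= n * n.
    apply: (le_trans H0); rewrite -natrM ler_nat -sum_nat_const.
    by apply: leq_sum => z _; apply: max_card.
  have [n_gt0|] := ltP 0 n; last first.
    move=> /(le_trans (card_le_n U)) H2; rewrite (le_trans H2) // mulr_ge0 // ltW //.
  rewrite -(ler_pM2r n_gt0) -(ler_pM2r c1); apply: (le_trans H1).
  by rewrite [leRHS](_ : _ = n * n) //; field; rewrite gt_eqF.
move=> W; have := maxU (U :|: W) isT; rewrite /f /=.
have -> : (\sum_z #|via h (U :|: W) z|)%:R =
   (\sum_z #|via h U z|)%:R + (\sum_z #|via h (U :|: W) z :\: via h U z|)%:R :> R.
  rewrite -natrD -big_split; congr (_%:R); apply: eq_bigr => z _ /=.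
  by rewrite -[LHS](cardsID (via h U z)) (setIidPr (viaU _ _ _ _)).
have : #|U :|: W|%:R * n / c <= (#|U|%:R + #|W|%:R) * n / c.
  by rewrite !ler_wpM2r ?(ltW c1) // -natrD ler_nat cardsU leq_subr.
rewrite !mulrDl; lra.
Qed.

End UpperRegular.

Section FewExceptions.
Variables (R : realFieldType) (V : finType) (g : rel V) (p eps C : R).
Local Notation n := (#|V|%:R : R).
Local Notation D := (p * n).
Hypotheses (p_gt0 : 0 < p) (n_gt0 : 0 < n) (Jg : upper_regular g p eps C).

(** Count the edges from [A] to [T]: the surplus [theta / 2] over the density [tau] beats [eps], and
    the remaining [theta / 4 * D] per vertex of [A] has to be paid out of [C * n]. *)
Lemma few_large_degree (tau theta eta : R) (T A : {set V}) :
  0 < theta -> eps <= theta / 4 -> C <= theta / 4 * eta * D ->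
  #|T|%:R <= tau * n ->
  (forall x, x \in A -> (tau + theta / 2) * D <= (rdeg g x T)%:R) ->
  #|A|%:R <= eta * n.
Proof.
move=> th0 epsth CD Tn hA.
have D0 : 0 < D by rewrite mulr_gt0.
have h1 := ec_ge hA; have h2 := Jg A T.
have A0 : 0 <= #|A|%:R :> R by rewrite ler0n.
have h3 : p * #|A|%:R * #|T|%:R <= #|A|%:R * (tau * D).
  by have := ler_wpM2l (mulr_ge0 (ltW p_gt0) A0) Tn; lra.
have h4 : eps * D * #|A|%:R <= #|A|%:R * (theta / 4 * D).
  by have := ler_wpM2r (mulr_ge0 (ltW D0) A0) epsth; lra.
have h5 := ler_wpM2r (ltW n_gt0) CD.
have k : 0 < theta / 4 * D by rewrite mulr_gt0 //; lra.
rewrite -(ler_pM2l k); lra.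
Qed.

(** The same count read for the size of [T]: a set [A] of order [D], such as a neighbourhood, is
    already large enough to absorb [C * n]. *)
Lemma large_neighbourhood (t theta : R) (T A : {set V}) :
  0 < theta -> eps <= theta / 4 -> C * n <= theta / 20 * D ^+ 2 ->
  D / 5 <= #|A|%:R ->
  (forall x, x \in A -> t * D <= (rdeg g x T)%:R) ->
  (t - theta) * n <= #|T|%:R.
Proof.
move=> th0 epsth CD DA hA.
have D0 : 0 < D by rewrite mulr_gt0.
have h1 := ec_ge hA; have h2 := Jg A T.
have A0 : 0 < #|A|%:R :> R by apply: lt_le_trans DA; lra.
have h4 : eps * D * #|A|%:R <= #|A|%:R * (theta / 4 * D).
  by have := ler_wpM2r (mulr_ge0 (ltW D0) (ltW A0)) epsth; lra.
have h5 : theta / 20 * D ^+ 2 <= theta / 4 * D * #|A|%:R.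
  have k : 0 <= theta / 4 * D by rewrite mulr_ge0 ?ltW //; lra.
  by have := ler_wpM2l k DA; lra.
have k : 0 < p * #|A|%:R by rewrite mulr_gt0.
have h6 : 0 <= theta / 2 * D * #|A|%:R by rewrite !mulr_ge0 ?ltW //; lra.
rewrite -(ler_pM2l k); lra.
Qed.

End FewExceptions.

Section Saturation.
Variables (R : realFieldType) (V : finType) (g h : rel V) (p eps C : R).
Local Notation n := (#|V|%:R : R).
Local Notation D := (p * n).
Hypotheses (p_gt0 : 0 < p) (p_le1 : p <= 1) (n_gt0 : 0 < n) (C_ge0 : 0 <= C).
Hypotheses (Jg : upper_regular g p eps C).
Hypotheses (hsym : symmetric h) (hg : forall x y, h x y -> g x y).

(* For W of size w, the pairs of neighbours of a vertex of W lie in via h (U :|: W),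
   so only the few pairs gained by adding W to U can fail to lie in via h U; these
   are spread almost evenly over the neighbourhoods of W. *)
Lemma few_unsaturated (U : {set V}) (mu c : R) (w : nat) :
  (forall W : {set V},
     (\sum_z #|via h (U :|: W) z :\: via h U z|)%:R <= #|W|%:R * n / c) ->
  0 < c -> 0 < mu -> mu <= 1 -> eps <= mu -> (0 < w)%N ->
  w%:R <= mu ^+ 2 * c * n -> 2 * C * n ^+ 2 <= mu * D ^+ 2 * w%:R ->
  C * n <= D * w%:R ->
  (#|[set x | 9 * mu * D ^+ 2 <
      (\sum_(z | h x z) #|[set y | h x y] :\: via h U z|)%:R]%R| < w)%N.
Proof.
move=> satU c0 mu0 mu1 epsmu w0 wc Cw1 Cw2; rewrite ltnNge; apply/negP.
move=> /exists_subset_card [W /subsetP WX Ww].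
have D0 : 0 < D by rewrite mulr_gt0.
pose De z := via h (U :|: W) z :\: via h U z.
pose NW z := [set x in W | h x z].
pose Z := [set z | mu * n < #|De z|%:R].
have sDe : (\sum_z #|De z|)%:R <= mu ^+ 2 * n * n.
  apply: le_trans (satU W) _; rewrite Ww ler_pdivrMr //.
  by have := ler_wpM2r (ltW n_gt0) wc; lra.
(* Markov's inequality: the total gain is at most mu ^ 2 n ^ 2. *)
have Zmu : #|Z|%:R <= mu * n.
  have k : 0 < mu * n by rewrite mulr_gt0.
  rewrite -(ler_pM2r k); apply: (@le_trans _ _ (\sum_z #|De z|)%:R); last first.
    by apply: le_trans sDe _; rewrite expr2; lra.
  rewrite mulr_natl -sumr_const natr_sum big_mkcond /=; apply: ler_sum => z _.
  by rewrite inE; case: ifP => [/ltW|_] //; rewrite ler0n.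
have swap (B : {set V}) : (\sum_(z in B) #|NW z| = ec h W B)%N.
  by rewrite ec_exchange.
have nat1 : (\sum_(x in W) \sum_(z | h x z) #|[set y | h x y] :\: via h U z| <=
             \sum_z ec g (NW z) (De z))%N.
  rewrite (exchange_big_dep xpredT) //=; apply: leq_sum => z _.
  rewrite /ec [leqRHS](eq_bigl (fun x => (x \in W) && h x z)); last first.
    by move=> x; rewrite inE.
  apply: leq_sum => x /andP[xW hxz]; apply: subset_leq_card.
  apply/subsetP => y; rewrite in_setD [y \in [set _ | _]]inE => /andP[nv hxy].
  rewrite inE in_setD nv hg // andbT; apply/viaP; exists x; last by rewrite hxz.
  by rewrite inE xW orbT.
have bz z : (ec g (NW z) (De z))%:R <=
    2 * mu * D * #|NW z|%:R + (if z \in Z then D * #|NW z|%:R else 0) + C * n.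
  have a0 : 0 <= #|NW z|%:R :> R by rewrite ler0n.
  have := Jg (NW z) (De z).
  have h1 : eps * D * #|NW z|%:R <= mu * D * #|NW z|%:R.
    by rewrite !ler_wpM2r // ltW.
  have pa : 0 <= p * #|NW z|%:R by rewrite mulr_ge0 // ltW.
  have h3 : 0 <= mu * (D * #|NW z|%:R) by rewrite !mulr_ge0 // ltW.
  case: ifP => [_|zZ].
    have h2 := ler_wpM2l pa (card_le_n R (De z)); lra.
  have h2 : #|De z|%:R <= mu * n.
    by move: zZ; rewrite inE ltNge => /negbFE.
  have h4 := ler_wpM2l pa h2; lra.
have tot : (\sum_z ec g (NW z) (De z))%:R <=
    2 * mu * D * (ec g W setT)%:R + D * (ec g W Z)%:R + C * n * n.
  rewrite natr_sum; apply: (le_trans (ler_sum _ (fun z _ => bz z))).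
  rewrite !big_split /= -mulr_sumr -big_mkcond /= -mulr_sumr -!natr_sum.
  rewrite (eq_bigl (mem [set: V])) => [|z]; last by rewrite /= inE.
  rewrite !swap sumr_const -[X in _ + X]mulr_natr cardT -cardE.
  have e1 : (ec h W setT)%:R <= (ec g W setT)%:R :> R by rewrite ler_nat ec_le.
  have e2 : (ec h W Z)%:R <= (ec g W Z)%:R :> R by rewrite ler_nat ec_le.
  have k : 0 <= 2 * mu * D by rewrite mulr_ge0 ?(ltW D0) //; lra.
  have := ler_wpM2l k e1; have := ler_wpM2l (ltW D0) e2; lra.
have low : w%:R * (9 * mu * D ^+ 2) <
   (\sum_(x in W) \sum_(z | h x z) #|[set y | h x y] :\: via h U z|)%:R.
  rewrite -{1}Ww mulr_natl -sumr_const natr_sum.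
  have [x0 x0W] : exists x0, x0 \in W by apply/set0Pn; rewrite -card_gt0 Ww.
  apply: ltr_sum => [|x /WX]; last by rewrite inE.
  by apply/hasP; exists x0; rewrite ?mem_index_enum.
have w0' : 0 < w%:R :> R by rewrite ltr0n.
have J1 := Jg W setT; have J2 := Jg W Z; rewrite cardsT Ww in J1; rewrite Ww in J2.
have Dw : 0 < D * w%:R by rewrite mulr_gt0.
have J1' : (ec g W setT)%:R <= 3 * (D * w%:R).
  have : eps * D * w%:R <= 1 * (D * w%:R).
    by rewrite -mulrA ler_wpM2r ?(ltW Dw) // (le_trans epsmu).
  lra.
have J2' : (ec g W Z)%:R <= 2 * mu * (D * w%:R) + C * n.
  have : eps * D * w%:R <= mu * (D * w%:R) by rewrite -mulrA ler_wpM2r ?(ltW Dw).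
  have pw : 0 <= p * w%:R by rewrite mulr_ge0 // ltW.
  have := ler_wpM2l pw Zmu; lra.
have Dn : D <= n by rewrite -[leRHS]mul1r ler_wpM2r // ltW.
have k1 : 0 <= 2 * mu * D by rewrite mulr_ge0 ?(ltW D0) //; lra.
(* The constant 9 is 6 + 2 + 1, in units of mu D ^ 2 w: 6 from all edges leaving [W], 2 from the
   edges into [Z], and 1 from the two remaining terms, each at most C n ^ 2. *)
have t1 := ler_wpM2l k1 J1'.
have t2 := ler_wpM2l (ltW D0) J2'.
have t3 := ler_wpM2l (mulr_ge0 C_ge0 (ltW n_gt0)) Dn.
have nat1' := nat1; rewrite -(ler_nat R) in nat1'.
lra.
Qed.

End Saturation.

(** * Near-bipartiteness *)

Section SecondNeighbourhoods.
Variables (R : realFieldType) (V : finType) (h : rel V) (U : {set V}) (l : R).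
Local Notation n := (#|V|%:R : R).

Definition sec z : {set V} := via h U z :\: U.

(* Unlike sec, which only sees common neighbours in the possibly exceptional set U,
   twin relates any two neighbours of a typical vertex (krel_twin), and it separates
   the ends of a typical edge (krel_disj). *)
Definition twin z : {set V} :=
  [set y | [&& y \notin U, #|sec y|%:R <= (1 - l) * n
             & l * n <= #|sec z :&: sec y|%:R]].

(** All three kinds depend on [h] only through its edges meeting [U]. There are 3 n descriptors, so
    a choice of two of them for every vertex is affordable in a union bound. *)
Definition region (d : option bool * V) : {set V} :=
  match d with
  | (None, z) => sec z
  | (Some true, z) => ~: sec z
  | (Some false, z) => twin z
  end.

End SecondNeighbourhoods.

(* Every inequality between overlaps of the sets s x used below is an instance of
   card_inter_le; they are contradictory because l > 2/5. *)
Section Bipartition.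
Variables (R : realFieldType) (V : finType) (k : rel V) (s : V -> {set V}) (l : R).
Variables (V3 V4 : {set V}).
Local Notation n := (#|V|%:R : R).
Hypotheses (n_gt0 : 0 < n) (l_big : 2 < 5 * l) (ksym : symmetric k).
Hypotheses (V43 : V4 \subset V3).
Hypothesis edge_disj : forall x y, k x y -> s x :&: s y = set0.
Hypothesis s_big : forall x, x \in V3 -> l * n <= #|s x|%:R.

Let ln : 2 * n < 5 * (l * n).
Proof. by rewrite mulrA ltr_pM2r. Qed.

Lemma card_inter_leR (A B X : {set V}) :
  #|A :&: B|%:R + #|A :&: X|%:R <= #|A|%:R + #|B :&: X|%:R :> R.
Proof. by rewrite -!natrD ler_nat card_inter_le. Qed.

Lemma edge_small x y : x \in V3 -> k x y -> #|s y|%:R <= (1 - l) * n.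
Proof.
move=> x3 kxy; have := s_big x3; have := card_inter_leR setT (s x) (s y).
rewrite (edge_disj kxy) cards0 !setTI cardsT; lra.
Qed.

(** In the intended bipartition these are vertices on the side of [x0]. *)
Definition near x0 : {set V} :=
  [set v | (#|s v|%:R <= (1 - l) * n) && (l * n <= #|s x0 :&: s v|%:R)].

Lemma near_disj x0 z0 : k x0 z0 -> near x0 :&: near z0 = set0.
Proof.
move=> kxz; apply/setP => v; rewrite [RHS]inE; apply/negP; rewrite !inE.
move=> /andP[/andP[sv xv] /andP[_ zv]].
have := card_inter_leR (s v) (s x0) (s z0).
by rewrite (edge_disj kxz) cards0 [s v :&: s x0]setIC [s v :&: s z0]setIC; have := ln; have := n_gt0; lra.
Qed.

(** The sets [s v] and [s v'] share at least (3 l - 1) n points inside [s x0]. These points avoid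
    the disjoint sets [s y] and [s y'], which cover 2 l n. Hence 5 l <= 2, against [l_big]. *)
Lemma near_edge_cross x0 y y' v v' :
  #|s x0|%:R <= (1 - l) * n -> y \in V3 -> y' \in V3 ->
  k y y' -> k y v -> k y' v' -> v \in near x0 -> v' \in near x0 -> False.
Proof.
move=> sx0 y3 y3' kyy kyv kyv'; rewrite !inE => /andP[sv xv] /andP[sv' xv'].
have h1 := card_inter_leR (s x0) (s v) (s v').
have h2 := card_inter_leR setT (s y) (s y').
have h3 := card_inter_leR setT (s y :|: s y') (s v :&: s v').
have e1 : (s y :|: s y') :&: (s v :&: s v') = set0.
  rewrite setIUl setIA (edge_disj kyv) set0I set0U.
  by rewrite setIC -setIA [s v' :&: _]setIC (edge_disj kyv') setI0.
have e2 : #|s y :|: s y'|%:R = #|s y|%:R + #|s y'|%:R :> R.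
  by rewrite cardsU (edge_disj kyy) cards0 subn0 natrD.
move: h3; rewrite e1 cards0 !setTI cardsT e2.
have := s_big y3; have := s_big y3'; have := ln; have := n_gt0; lra.
Qed.

Lemma bipartition_of_twins x0 z0 : x0 \in V3 -> z0 \in V3 -> k x0 z0 ->
  (forall y, y \in V4 -> exists2 v, k y v & v \in near x0 :|: near z0) ->
  exists X : {set V}, forall y y', y \in V4 -> y' \in V4 -> k y y' ->
    (y \in X) != (y' \in X).
Proof.
move=> x3 z3 kxz ex.
have sz : #|s z0|%:R <= (1 - l) * n := edge_small x3 kxz.
have sx : #|s x0|%:R <= (1 - l) * n by apply: (edge_small z3); rewrite ksym.
(* [near_edge_cross] at [x0] forbids an edge within this set, and at [z0] an edge outside it. *)
exists [set y | [exists v, k y v && (v \in near x0)]] => y y' y4 y4' kyy.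
have y3 := subsetP V43 _ y4; have y3' := subsetP V43 _ y4'.
rewrite !inE.
have [/existsP[v /andP[kyv vx]]|/existsPn nv] := boolP [exists v, k y v && (v \in near x0)];
  have [/existsP[v' /andP[kyv' vx']]|/existsPn nv'] :=
    boolP [exists v, k y' v && (v \in near x0)] => //.
  by case: (near_edge_cross sx y3 y3' kyy kyv kyv').
have [v kyv] := ex y y4; rewrite inE => /orP[vx|vz].
  by have := nv v; rewrite kyv vx.
have [v' kyv'] := ex y' y4'; rewrite inE => /orP[vx'|vz'].
  by have := nv' v'; rewrite kyv' vx'.
by case: (near_edge_cross sz y3 y3' kyy kyv kyv').
Qed.

End Bipartition.

(** * Typical edges, pruning, and the near-bipartition of [h] *)

Section NearlyBipartite.
Variables (R : realFieldType) (V : finType) (g h : rel V) (p eps C : R).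
Variables (theta eta c h0 : R) (w : nat) (U : {set V}).
Local Notation n := (#|V|%:R : R).
Local Notation D := (p * n).
Local Notation l := (h0 - 4 * theta).
Local Notation sec := (sec h U).
Local Notation twin := (twin h U l).
Local Notation region := (region h U l).
Hypotheses (p_gt0 : 0 < p) (p_le1 : p <= 1) (n_gt0 : 0 < n) (C_ge0 : 0 <= C).
Hypotheses (Jg : upper_regular g p eps C).
Hypotheses (hsym : symmetric h) (hg : forall x y, h x y -> g x y).
Hypothesis tri : forall x y z, h x y -> h y z -> h x z -> False.
Hypothesis hdeg : forall x, h0 * D <= (rdeg h x setT)%:R.
Hypotheses (theta_gt0 : 0 < theta) (eta_gt0 : 0 < eta) (eta_le : 100 * eta <= theta ^+ 2).
Hypotheses (l_big : 2 < 5 * l) (theta_le : theta <= 1).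
Hypotheses (eps_le : eps <= theta / 4) (eps_le_eta : eps <= theta * eta).
Hypotheses (c_gt0 : 0 < c) (c_le : c <= eta) (U_small : #|U|%:R <= c * n).
Hypothesis satU : forall W : {set V},
  (\sum_z #|via h (U :|: W) z :\: via h U z|)%:R <= #|W|%:R * n / c.
Hypotheses (w_gt0 : (0 < w)%N) (w_le : w%:R <= (theta * eta) ^+ 2 * c * n).
Hypotheses (w_ge1 : 2 * C * n ^+ 2 <= theta * eta * D ^+ 2 * w%:R).
Hypotheses (w_ge2 : C * n <= D * w%:R).
Hypotheses (C_le1 : C <= theta / 4 * eta * D) (C_le2 : C * n <= theta / 20 * D ^+ 2).

(** Two descriptors are allowed because the arguments below use intersections of two regions.
    Targets exclude [U] because the edges at [U] determine the regions. *)
Definition atypical_degree : {set V} :=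
  [set v | (v \notin U) && [exists d1, exists d2,
     p * #|region d1 :&: region d2|%:R + theta * D <
     (rdeg g v ((region d1 :&: region d2) :\: U))%:R]].
Hypothesis few_atypical : #|atypical_degree|%:R <= eta * n.

Let D_gt0 : 0 < D. Proof. exact: mulr_gt0. Qed.
Let eta_small : 100 * eta <= theta.
Proof.
have := theta_le; have := theta_gt0; have := eta_le => a b d.
by apply: (le_trans a); rewrite expr2 -[leRHS]mulr1 ler_wpM2l // ltW.
Qed.

Definition unsaturated : {set V} := [set x | 9 * (theta * eta) * D ^+ 2 <
  (\sum_(z | h x z) #|[set y | h x y] :\: via h U z|)%:R].

Definition V1 : {set V} := [set x | [&& x \notin U, x \notin unsaturated,
  (rdeg g x U)%:R < theta * D & x \notin atypical_degree]].

Definition typical x z : bool := (rdeg h x (~: via h U z))%:R <= theta * D.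

Definition krel : rel V := fun x z =>
  [&& h x z, x \in V1, z \in V1, typical x z & typical z x].

Definition lost : rel V := fun x z => h x z && ~~ krel x z.

(* Each step of V1, V2, V3, V4 discards few vertices and keeps the degrees in krel
   above 2/5 * D; a vertex of V4 can be followed along two typical edges. *)
Definition V2 : {set V} := [set x | (rdeg lost x setT)%:R <= theta * D].
Definition V3 : {set V} :=
  [set x in V2 | (h0 - 2 * theta) * D <= (rdeg krel x V2)%:R].
Definition V4 : {set V} :=
  [set x in V3 | (h0 - 2 * theta) * D <= (rdeg krel x V3)%:R].

Lemma krel_sym : symmetric krel.
Proof.
move=> x y; rewrite /krel hsym [typical x y && _]andbC.
by case: (x \in V1); case: (y \in V1).
Qed.

Lemma krel_h x y : krel x y -> h x y. Proof. by case/andP. Qed.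

Lemma rdeg_lost x : (rdeg krel x setT + rdeg lost x setT = rdeg h x setT)%N.
Proof.
rewrite /rdeg -[RHS](cardsID [set y | krel x y]); congr (_ + _)%N.
  congr #|pred_of_set _|; apply/setP => y; rewrite !inE /=.
  by case E: (krel x y); rewrite ?andbF // (krel_h E) //.
by congr #|pred_of_set _|; apply/setP => y; rewrite !inE /lost /= andbC.
Qed.

Lemma V2_V1 : V2 \subset V1.
Proof.
apply/subsetP => x; rewrite inE => h1; apply/negPn/negP => x1.
have := rdeg_lost x.
have -> : rdeg krel x setT = 0%N.
  by apply: rdeg0 => y _; rewrite /krel (negPf x1) andbF.
rewrite add0n => e; have := hdeg x; rewrite -e => h2.
have := le_trans h2 h1; rewrite ler_pM2r //.
have := theta_gt0; have := l_big; lra.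
Qed.

(** At least [(h0 - theta - e) * D] edges at [x] end in the intersection and outside [U], and a
    vertex of [V1] sends there at most [theta * D] edges above density [p]. This turns
    near-containment of a neighbourhood into a linear lower bound on a size. *)
Lemma region_lower x d1 d2 (e : R) : x \in V1 ->
  (rdeg h x (~: (region d1 :&: region d2) :\: U))%:R <= e * D ->
  (h0 - 2 * theta - e) * n <= #|region d1 :&: region d2|%:R.
Proof.
rewrite inE => /and4P[xU _ degU xat]; set T := region d1 :&: region d2 => he.
have h1 : (rdeg g x (T :\: U))%:R <= p * #|T|%:R + theta * D.
  rewrite leNgt; apply/negP => lt; case/negP: xat; rewrite inE xU.
  by apply/existsP; exists d1; apply/existsP; exists d2.
have h2 : (rdeg h x setT <= rdeg g x U + rdeg h x (~: T :\: U) + rdeg g x (T :\: U))%N.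
  rewrite (rdegC h x U) -addnA leq_add ?rdeg_le //; first by move=> y _ /hg.
  rewrite addnC (rdegID h x (~: U) T) setIC -setDE leq_add //.
    by apply: rdeg_le => y _ /hg.
  by apply: rdegS; apply/subsetP => y; rewrite !inE andbC.
have h3 := hdeg x.
have h4 : (rdeg h x setT)%:R <= (rdeg g x U)%:R + (rdeg h x (~: T :\: U))%:R +
  (rdeg g x (T :\: U))%:R :> R by rewrite -!natrD ler_nat.
have k := p_gt0; rewrite -(ler_pM2l k); lra.
Qed.

(** The neighbours of [x] avoid [sec x], as a common neighbour in [U] would close a triangle; so the
    complement of [sec x] is large. *)
Lemma sec_small x : x \in V1 -> #|sec x|%:R <= (1 - l) * n.
Proof.
move=> x1; have := @region_lower x (Some true, x) (Some true, x) 0 x1.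
rewrite /= setIid => /(_ _) H.
have : #|sec x|%:R + #|~: sec x|%:R = n by rewrite -natrD cardsC.
have : (h0 - 2 * theta - 0) * n <= #|~: sec x|%:R.
  apply: H; rewrite mul0r rdeg0 // => y; rewrite in_setD in_setC in_setC negbK.
  case/andP=> _; rewrite in_setD => /andP[_ /viaP[u _ /andP[hux huy]]].
  by apply/negP => hxy; apply: (tri hux hxy huy).
have := mulr_gt0 theta_gt0 n_gt0; lra.
Qed.

(** By typicality most neighbours of [x] outside [U] lie in [sec z], and none lies in [sec x]. So
    much of [sec z], which is not large itself, is outside [sec x]. *)
Lemma typical_edge x z : x \in V1 -> z \in V1 -> h x z -> typical x z ->
  #|sec x :&: sec z|%:R <= (1 - 2 * l) * n.
Proof.
move=> x1 z1 hxz t.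
have /= h1 := @region_lower x (None, z) (Some true, x) theta x1.
have h2 : (h0 - 2 * theta - theta) * n <= #|sec z :&: ~: sec x|%:R.
  apply: h1; apply: le_trans t; rewrite ler_nat; apply: rdeg_sub => y.
  rewrite in_setD in_setC in_setI in_setC negb_and negbK !in_setD in_setC.
  case/andP => ->; case/orP => //= /viaP[u _ /andP[hux huy]] hxy.
  by case: (tri hux hxy huy).
have := sec_small z1.
have : #|sec z :&: sec x|%:R + #|sec z :&: ~: sec x|%:R = #|sec z|%:R :> R.
  by rewrite -natrD -setDE cardsID.
rewrite setIC; have := mulr_gt0 theta_gt0 n_gt0; lra.
Qed.

Lemma typical_cherry u x y : u \in V1 -> typical u x -> typical u y ->
  l * n <= #|sec x :&: sec y|%:R.
Proof.
move=> u1 tx ty; have /= h1 := @region_lower u (None, x) (None, y) (2 * theta) u1.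
have h2 : (h0 - 2 * theta - 2 * theta) * n <= #|sec x :&: sec y|%:R.
  apply: h1; apply: (@le_trans _ _ ((rdeg h u (~: via h U x))%:R +
    (rdeg h u (~: via h U y))%:R)); last by move: tx ty; rewrite /typical; lra.
  rewrite -natrD ler_nat; apply: leq_trans (rdegU _ _ _ _).
  apply: rdegS; apply/subsetP => z; rewrite !inE => /andP[zU].
  by rewrite zU /= negb_and.
by move: h2; lra.
Qed.

(** A common element [z] would force [sec x] and [sec y] to share (3 l - 1) n points of [sec z],
    more than n / 5, whereas [typical_edge] allows only (1 - 2 l) n, less than n / 5. *)
Lemma krel_disj x y : krel x y -> twin x :&: twin y = set0.
Proof.
case/and5P => hxy x1 y1 t _; apply/setP => z; rewrite [RHS]inE; apply/negP.
rewrite !inE => /andP[/and3P[_ sz xz] /and3P[_ _ yz]].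
have := card_inter_leR R (sec z) (sec x) (sec y).
have := typical_edge x1 y1 hxy t.
rewrite [sec z :&: _]setIC [sec z :&: sec y]setIC.
have : 2 * n < 5 * (l * n) by rewrite mulrA ltr_pM2r //; exact: l_big.
have := n_gt0; lra.
Qed.

Lemma krel_twin u x y : krel u x -> krel u y -> y \in twin x.
Proof.
case/and5P => _ u1 x1 tx _ /and5P[_ _ y1 ty _].
rewrite inE sec_small // (typical_cherry u1) // !andbT.
by move: y1; rewrite inE => /and4P[].
Qed.

(** [region_lower] with twin regions: all [krel]-neighbours of [u] lie in both twin sets, and at a
    vertex of [V2] at most [theta * D] edges are lost. *)
Lemma krel_cherry u x y : u \in V2 -> krel u x -> krel u y ->
  l * n <= #|twin x :&: twin y|%:R.
Proof.
move=> u2 kux kuy.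
have /= h1 := @region_lower u (Some false, x) (Some false, y) theta (subsetP V2_V1 _ u2).
have : (h0 - 2 * theta - theta) * n <= #|twin x :&: twin y|%:R.
  apply: h1; move: u2; rewrite inE; apply: le_trans; rewrite ler_nat.
  apply: (@leq_trans (rdeg lost u (~: (twin x :&: twin y) :\: U))); last first.
    by rewrite rdegS ?subsetT.
  apply: rdeg_le => z; rewrite in_setD => /andP[_]; rewrite in_setC => nz huz.
  rewrite /lost huz /=; apply: contra nz => kuz.
  by rewrite inE (krel_twin kux kuz) (krel_twin kuy kuz).
have := mulr_gt0 theta_gt0 n_gt0; lra.
Qed.

Lemma V2_degree u (T : {set V}) : u \in V2 -> (forall v, krel u v -> v \in T) ->
  (h0 - theta) * D <= (rdeg g u T)%:R.
Proof.
rewrite inE => u2 uT; have := hdeg u; rewrite -rdeg_lost natrD.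
have : (rdeg krel u setT)%:R <= (rdeg g u T)%:R :> R.
  rewrite ler_nat; apply: subset_leq_card; apply/subsetP => y.
  by rewrite !inE => kuy; rewrite uT // hg // krel_h.
lra.
Qed.

(** Second neighbourhoods have linear size: [z] has more than D / 5 [krel]-neighbours in [A], and
    each sends at least [(h0 - theta) * D] edges into [T]. *)
Lemma neighbours_fill z (A T : {set V}) : A \subset V2 ->
  (h0 - 2 * theta) * D <= (rdeg krel z A)%:R ->
  (forall u v, u \in A -> krel z u -> krel u v -> v \in T) ->
  l * n <= #|T|%:R.
Proof.
move=> AV2 zA AT.
have : (h0 - theta - theta) * n <= #|T|%:R.
  apply: (large_neighbourhood p_gt0 n_gt0 Jg theta_gt0 eps_le C_le2
    (A := [set u in A | krel z u])).
    apply: le_trans zA; rewrite mulrC ler_wpM2r ?(ltW D_gt0) //.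
    by have := l_big; have := theta_gt0; lra.
  move=> u; rewrite inE => /andP[uA kzu]; apply: V2_degree.
    exact: (subsetP AV2).
  by move=> v; apply: AT.
have := mulr_gt0 theta_gt0 n_gt0; lra.
Qed.

Lemma twin_big z : z \in V3 -> l * n <= #|twin z|%:R.
Proof.
rewrite inE => /andP[_ z3]; apply: (neighbours_fill _ z3) => // u v _ kzu.
by apply: krel_twin; rewrite krel_sym.
Qed.

Lemma V3_V2 : V3 \subset V2.
Proof. by apply/subsetP => x; rewrite inE => /andP[]. Qed.

Lemma V4_V3 : V4 \subset V3.
Proof. by apply/subsetP => x; rewrite inE => /andP[]. Qed.

(** The vertices reached from [x0] by two typical edges through [V3] are near [x0]. The middle
    vertex has to be in [V3] for [edge_small], hence the second pruning to [V4]. *)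
Lemma near_big x0 : x0 \in V4 -> l * n <= #|near twin l x0|%:R.
Proof.
rewrite inE => /andP[_ x4]; apply: (neighbours_fill V3_V2 x4) => u v u3 kxu kuv.
rewrite inE (edge_small krel_disj twin_big u3 kuv) (krel_cherry (u := u)) //.
  exact: (subsetP V3_V2).
by rewrite krel_sym.
Qed.


Lemma ec_few (A : {set V}) (a : R) : #|A|%:R <= a * n ->
  (ec g A setT)%:R <= (a + 2 * eta) * (D * n).
Proof.
move=> An; have := Jg A setT; rewrite cardsT.
have Dn : 0 < D * n := mulr_gt0 D_gt0 n_gt0.
have h1 : p * #|A|%:R * n <= a * (D * n).
  by have := ler_wpM2l (ltW D_gt0) An; lra.
have h2 : eps * D * #|A|%:R <= eta * (D * n).
  apply: (@le_trans _ _ (eta * D * #|A|%:R)).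
    rewrite !ler_wpM2r ?(ltW D_gt0) ?ler0n // (le_trans eps_le_eta) //.
    by rewrite -[leRHS]mul1r ler_wpM2r ?(ltW eta_gt0).
  by rewrite -mulrA !ler_wpM2l ?(ltW D_gt0) ?(ltW eta_gt0) // card_le_n.
have h3 : C * n <= eta * (D * n).
  apply: (@le_trans _ _ (theta / 4 * eta * D * n)); first by rewrite ler_wpM2r // ltW.
  have k : 0 < eta * (D * n) by rewrite mulr_gt0.
  have : theta / 4 * (eta * (D * n)) <= 1 * (eta * (D * n)).
    by rewrite ler_wpM2r ?(ltW k) //; have := theta_le; lra.
  lra.
lra.
Qed.

Lemma few_not_V1 : #|~: V1|%:R <= 4 * eta * n.
Proof.
pose B := [set x | theta * D <= (rdeg g x U)%:R].
have sub : ~: V1 \subset (U :|: unsaturated) :|: (B :|: atypical_degree).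
  apply/subsetP => x; rewrite in_setC !in_setU /V1 inE !negb_and !negbK -leNgt.
  by rewrite [x \in B]inE -!orbA.
have hc : c * n <= eta * n by rewrite ler_wpM2r // ltW.
have hB : #|B|%:R <= eta * n.
  apply: (few_large_degree (tau := theta / 2) p_gt0 n_gt0 Jg theta_gt0 eps_le C_le1
    (T := U)).
    apply: (le_trans U_small); rewrite ler_wpM2r ?(ltW n_gt0) //.
    by have := eta_small; have := c_le; have := eta_gt0; lra.
  by move=> x; rewrite inE; apply: le_trans; rewrite ler_wpM2r ?(ltW D_gt0) //; lra.
have te : theta * eta <= 1.
  have := ler_wpM2r (ltW eta_gt0) theta_le; have := eta_small; have := theta_le.
  by have := eta_gt0; lra.
have te0 : 0 < theta * eta by rewrite mulr_gt0.
have hX : #|unsaturated|%:R <= eta * n.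
  apply: (@le_trans _ _ w%:R).
    rewrite ler_nat ltnW //; apply: (few_unsaturated p_gt0 p_le1 n_gt0 C_ge0 Jg hg satU) => //.
  apply: (le_trans w_le); rewrite ler_wpM2r ?(ltW n_gt0) // -[leRHS]mul1r.
  by rewrite ler_pM ?(ltW c_gt0) ?sqr_ge0 // exprn_ile1 // ltW.
have := subset_leq_card sub.
have := card_setU_le (U :|: unsaturated) (B :|: atypical_degree).
have := card_setU_le U unsaturated; have := card_setU_le B atypical_degree.
rewrite -!(ler_nat R) !natrD; have := few_atypical; have := U_small; lra.
Qed.

Definition atypical_pair : rel V := fun x z => [&& h x z, x \in V1 & ~~ typical x z].

(** At a vertex outside [unsaturated] each atypical pair takes more than [theta * D] out of a budget
    of [9 * (theta * eta) * D ^+ 2]. *)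
Lemma few_atypical_pairs : (ec atypical_pair setT setT)%:R <= 9 * eta * (D * n).
Proof.
have td : 0 < theta * D by rewrite mulr_gt0.
have deg x : (rdeg atypical_pair x setT)%:R <= 9 * eta * D.
  have [x1|x1] := boolP (x \in V1); last first.
    rewrite rdeg0 => [|z _]; last by rewrite /atypical_pair (negPf x1) andbF.
    by have := mulr_gt0 eta_gt0 D_gt0; lra.
  have := x1; rewrite inE => /and4P[_ + _ _]; rewrite inE -leNgt => unsat.
  rewrite -(ler_pM2r td); apply: le_trans (le_trans unsat _); last first.
    by rewrite expr2; lra.
  rewrite /rdeg mulr_natl -[leLHS]sumr_const natr_sum.
  rewrite [leRHS]big_mkcond [leLHS]big_mkcond.
  apply: ler_sum => z _; rewrite inE in_setT /= /atypical_pair x1 /=.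
  case: (boolP (h x z)) => //= hxz; case: ifPn => [|_]; last by rewrite ler0n.
  rewrite /typical -ltNge => /ltW /le_trans -> //; rewrite ler_nat.
  apply: subset_leq_card; apply/subsetP => y.
  by rewrite [y \in [set _ in _ | _]]inE in_setC in_setD [y \in [set _ | _]]inE.
rewrite natr_sum; apply: (le_trans (ler_sum _ (fun x _ => deg x))).
by rewrite sumr_const cardsT -[leLHS]mulr_natr; lra.
Qed.

Lemma few_lost : (ec lost setT setT)%:R <= 36 * eta * (D * n).
Proof.
pose b : rel V := fun x z => h x z && (x \notin V1).
pose fl (r : rel V) : rel V := fun x z => r z x.
have flE r : ec (fl r) setT setT = ec r setT setT.
  by rewrite [RHS]ec_exchange; apply: eq_bigr.
have sub x z : lost x z -> (b x z || fl b x z) || (atypical_pair x z || fl atypical_pair x z).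
  rewrite /lost /krel /b /fl /atypical_pair [h z x]hsym => /andP[-> /=].
  case: (x \in V1); case: (z \in V1) => //=.
  by rewrite negb_and.
have h1 : (ec b setT setT <= ec g (~: V1) setT)%N.
  rewrite /ec big_mkcond [leqRHS]big_mkcond; apply: leq_sum => x _.
  rewrite in_setT in_setC; case: ifPn => x1; first by apply: rdeg_le => y _ /andP[/hg].
  by rewrite rdeg0 // => y _; rewrite /b (negbTE x1) andbF.
have h2 := ec_or setT setT sub.
have h3 := ec_or setT setT (fun x y (H : b x y || fl b x y) => H).
have h4 := ec_or setT setT (fun x y (H : atypical_pair x y || fl atypical_pair x y) => H).
rewrite flE in h3; rewrite flE in h4.
move: h1 h2 h3 h4; rewrite -!(ler_nat R) !natrD.
have := few_atypical_pairs; have := ec_few few_not_V1.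
have := mulr_gt0 eta_gt0 (mulr_gt0 D_gt0 n_gt0); lra.
Qed.

Lemma few_not_V2 : #|~: V2|%:R <= 36 * eta / theta * n.
Proof.
have td : 0 < theta * D by rewrite mulr_gt0.
rewrite -(ler_pM2r td); apply: (@le_trans _ _ (ec lost (~: V2) setT)%:R).
  by apply: ec_ge => x; rewrite in_setC inE -ltNge => /ltW.
apply: (@le_trans _ _ (ec lost setT setT)%:R); first by rewrite ler_nat ecS ?subsetT.
apply: (le_trans few_lost); rewrite le_eqVlt; apply/orP; left; apply/eqP.
by field; rewrite gt_eqF.
Qed.

(** A vertex of [V2] has lost at most [theta * D] edges, so these vertices send more than
    [theta * D] edges of [g] into the complement of [A], whose density is at most [theta / 2]. *)
Lemma pruned (A : {set V}) : #|~: A|%:R <= theta / 2 * n ->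
  #|[set x in V2 | (rdeg krel x A)%:R < (h0 - 2 * theta) * D]|%:R <= eta * n.
Proof.
move=> An; apply: (few_large_degree p_gt0 n_gt0 Jg theta_gt0 eps_le C_le1 An) => x.
rewrite inE => /andP[x2 xA].
have : (rdeg krel x (~: A))%:R <= (rdeg g x (~: A))%:R :> R.
  by rewrite ler_nat; apply: rdeg_le => y _ /krel_h /hg.
have := hdeg x; rewrite -rdeg_lost (rdegC krel x A) !natrD.
move: x2; rewrite inE; lra.
Qed.

Let eta_theta : 50 * eta / theta <= theta / 2.
Proof.
rewrite ler_pdivrMr // mulrAC -expr2 ler_pdivlMr //.
by have := eta_le; lra.
Qed.
Let eta_le_div : eta <= eta / theta.
Proof. by rewrite ler_pdivlMr // -[leRHS]mulr1 ler_wpM2l // ltW. Qed.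

Lemma few_not_V3 : #|~: V3|%:R <= 37 * eta / theta * n.
Proof.
have h1 := few_not_V2.
have h2 : #|~: V2|%:R <= theta / 2 * n.
  apply: (le_trans h1); rewrite ler_wpM2r ?(ltW n_gt0) //.
  by have := eta_theta; have := eta_le_div; have := eta_gt0; lra.
have h3 := pruned h2.
have : ~: V3 \subset ~: V2 :|: [set x in V2 | (rdeg krel x V2)%:R < (h0 - 2 * theta) * D].
  apply/subsetP => x; rewrite in_setC in_setU in_setC => x3.
  case: (boolP (x \in V2)) => //= x2; rewrite inE x2 /= ltNge.
  by apply: contra x3 => H; rewrite inE x2 H.
move=> /subset_leq_card /leq_trans/(_ (card_setU_le _ _)).
rewrite -(ler_nat R) natrD; have := ler_wpM2r (ltW n_gt0) eta_le_div; lra.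
Qed.

Lemma few_not_V4 : #|~: V4|%:R <= 38 * eta / theta * n.
Proof.
have h1 := few_not_V3.
have h2 : #|~: V3|%:R <= theta / 2 * n.
  apply: (le_trans h1); rewrite ler_wpM2r ?(ltW n_gt0) //.
  by have := eta_theta; have := eta_le_div; have := eta_gt0; lra.
have h3 := pruned h2.
have : ~: V4 \subset ~: V3 :|: [set x in V2 | (rdeg krel x V3)%:R < (h0 - 2 * theta) * D].
  apply/subsetP => x; rewrite in_setC in_setU in_setC => x4.
  case: (boolP (x \in V3)) => //= x3; rewrite inE (subsetP V3_V2 _ x3) /= ltNge.
  by apply: contra x4 => H; rewrite inE x3 H.
move=> /subset_leq_card /leq_trans/(_ (card_setU_le _ _)).
rewrite -(ler_nat R) natrD; have := ler_wpM2r (ltW n_gt0) eta_le_div; lra.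
Qed.

Lemma krel_bipartite : exists X G : {set V}, #|~: G|%:R <= 39 * eta / theta * n /\
  forall y y', y \in G -> y' \in G -> krel y y' -> (y \in X) != (y' \in X).
Proof.
have [/existsP[x0 /existsP[z0 /and3P[x4 z4 kxz]]]|no] :=
  boolP [exists x0, exists z0, [&& x0 \in V4, z0 \in V4 & krel x0 z0]]; last first.
  exists set0, V4; split.
    apply: (le_trans few_not_V4); rewrite ler_wpM2r ?(ltW n_gt0) //.
    by have := eta_le_div; have := eta_gt0; lra.
  move=> y y' y4 y4' kyy; case/negP: no; apply/existsP; exists y.
  by apply/existsP; exists y'; rewrite y4 y4' kyy.
have x3 := subsetP V4_V3 _ x4; have z3 := subsetP V4_V3 _ z4.
set A := near twin l x0; set B := near twin l z0.
pose L := ~: (A :|: B).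
(* [L] is too small to receive all typical edges of a vertex of [V4] outside [B1], since h0 - 2
   theta exceeds 1 - 2 l + theta / 2. Such a vertex thus has a neighbour near [x0] or [z0]. *)
pose B1 := [set y | (1 - 2 * l + theta / 2) * D <= (rdeg g y L)%:R].
have AB : A :&: B = set0 := near_disj n_gt0 l_big krel_disj kxz.
have Ls : #|L|%:R <= (1 - 2 * l) * n.
  have e1 : #|A :|: B|%:R + #|L|%:R = n by rewrite -natrD cardsC.
  have e2 : #|A :|: B|%:R = #|A|%:R + #|B|%:R :> R by rewrite cardsU AB cards0 subn0 natrD.
  have := near_big x4; have := near_big z4; rewrite -/A -/B; lra.
have B1s : #|B1|%:R <= eta * n.
  apply: (few_large_degree p_gt0 n_gt0 Jg theta_gt0 eps_le C_le1 Ls) => x.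
  by rewrite inE.
have ex y : y \in V4 :\: B1 -> exists2 v, krel y v & v \in A :|: B.
  rewrite in_setD [y \in B1]inE -ltNge => /andP[yL y4].
  have : (0 < rdeg krel y (A :|: B))%N.
    rewrite lt0n; apply/eqP => e0.
    have : (rdeg krel y V3 <= rdeg g y L)%N.
      apply: (@leq_trans (rdeg krel y setT)); first by rewrite rdegS ?subsetT.
      rewrite (rdegC krel y (A :|: B)) e0 add0n.
      by apply: rdeg_le => v _ /krel_h /hg.
    move: y4; rewrite inE => /andP[_ y4]; rewrite -(ler_nat R) => h1.
    have h2 := le_lt_trans (le_trans y4 h1) yL.
    move: h2; rewrite ltr_pM2r //; have := l_big; have := theta_gt0; lra.
  by case/rdeg_mem => v vAB kyv; exists v.
have V4'3 : V4 :\: B1 \subset V3 by apply: subset_trans (subsetDl _ _) V4_V3.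
have [X hX] := bipartition_of_twins n_gt0 l_big krel_sym V4'3 krel_disj twin_big
  x3 z3 kxz ex.
exists X, (V4 :\: B1); split => //.
rewrite setCD; have := card_setU_le (~: V4) B1; rewrite -(ler_nat R) natrD.
have := few_not_V4; have := ler_wpM2r (ltW n_gt0) eta_le_div; lra.
Qed.

Lemma nearly_bipartite : exists X : {set V},
  (ec h X X + ec h (~: X) (~: X))%:R <= 200 * eta / theta * (D * n).
Proof.
have [X [G [Gs hX]]] := krel_bipartite.
exists X.
have side (Y : {set V}) : (forall y y', y \in Y :&: G -> y' \in Y :&: G -> ~~ krel y y') ->
    (ec h Y Y <= \sum_(x in Y) (rdeg lost x setT + rdeg h x (~: G)) + ec h (Y :\: G) setT)%N.
  move=> ind; rewrite (ecID h Y G) leq_add ?ecS ?subsetT ?subsetIl //.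
  rewrite /ec [leqRHS](big_setID G) /=; apply: leq_trans (leq_addr _ _).
  apply: leq_sum => x xYG; rewrite (rdegID h x Y G) leq_add //; last first.
    by apply: rdegS; apply/subsetP => y; rewrite !inE => /andP[].
  apply: (@leq_trans (rdeg lost x (Y :&: G))); last by rewrite rdegS ?subsetT.
  by apply: rdeg_le => y yG hxy; rewrite /lost hxy ind.
have h1 : (ec h X X <= \sum_(x in X) (rdeg lost x setT + rdeg h x (~: G)) + ec h (X :\: G) setT)%N.
  apply: side => y y'; rewrite !in_setI => /andP[yX yG] /andP[yX' yG'].
  by apply/negP => /(hX _ _ yG yG'); rewrite yX yX'.
have h2 : (ec h (~: X) (~: X) <= \sum_(x in ~: X) (rdeg lost x setT + rdeg h x (~: G)) + ec h (~: X :\: G) setT)%N.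
  apply: side => y y'; rewrite !in_setI !in_setC => /andP[yX yG] /andP[yX' yG'].
  by apply/negP => /(hX _ _ yG yG'); rewrite (negPf yX) (negPf yX').
have h3 : (ec h X X + ec h (~: X) (~: X) <= ec lost setT setT + 2 * ec g (~: G) setT)%N.
  apply: (leq_trans (leq_add h1 h2)); rewrite addnACA.
  have -> : (ec h (X :\: G) setT + ec h (~: X :\: G) setT = ec h (~: G) setT)%N.
    by rewrite (ecID h (~: G) X) !setDE [X :&: ~: G]setIC [~: X :&: ~: G]setIC.
  have -> : (\sum_(x in X) (rdeg lost x setT + rdeg h x (~: G)) +
      \sum_(x in ~: X) (rdeg lost x setT + rdeg h x (~: G)) =
      ec lost setT setT + ec h setT (~: G))%N.
    by rewrite -big_split /= [RHS](big_setID X) /= setTI setTD.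
  rewrite (ec_sym _ _ hsym) -addnA leq_add2l mul2n -addnn.
  by rewrite leq_add // ec_le.
move: h3; rewrite -(ler_nat R) (natrD _ (ec lost _ _)) natrM.
have := ec_few Gs; have := few_lost.
have Dn := mulr_gt0 D_gt0 n_gt0.
have := mulr_gt0 eta_gt0 Dn; have := ler_wpM2r (ltW Dn) eta_le_div; lra.
Qed.

End NearlyBipartite.

(** * Bernoulli random subsets and random graphs *)

(** An arbitrary ground set [B] is allowed because this is used both for the edges of the random
    graph and for random vertex samples. *)
Definition bern_weight (R : realType) (T : finType) (p : R) (B E : {set T}) : R :=
  \prod_(e in B) (if e \in E then p else 1 - p).

Definition bern_mean (R : realType) (T : finType) (p : R) (B : {set T})
    (f : {set T} -> R) : R :=
  \sum_(E in powerset B) bern_weight p B E * f E.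

Section Bernoulli.
Variables (R : realType) (T : finType) (p : R) (B : {set T}).
Hypotheses (p_ge0 : 0 <= p) (p_le1 : p <= 1).

Lemma sum_powerset_prod (F G : T -> R) :
  \sum_(E in powerset B) \prod_(e in B) (if e \in E then F e else G e) =
  \prod_(e in B) (F e + G e).
Proof.
rewrite [RHS]big_mkcond [RHS](eq_bigr (fun e =>
     (if e \in B then F e else 0) + (if e \in B then G e else 1))); last first.
  by move=> e _; case: ifP => _; rewrite ?add0r.
rewrite bigA_distr [RHS](bigID (fun E : {set T} => E \subset B)) /= [X in _ = _ + X]big1.
  rewrite addr0; apply: eq_big => [E|E]; first by rewrite powersetE.
  rewrite powersetE => /subsetP EB; rewrite big_mkcond; apply: eq_bigr => e _.
  by case: ifP => eB; case: ifP => // /EB; rewrite eB.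
move=> E /subsetPn [e eE enB].
by rewrite (bigD1 e) //= eE (negPf enB) mul0r.
Qed.

(** This is independence. Exponential moments of counts and indicators of containing a fixed set
    both have this product form. *)
Lemma bern_mean_prod (g : T -> bool -> R) :
  bern_mean p B (fun E => \prod_(e in B) g e (e \in E)) =
  \prod_(e in B) (p * g e true + (1 - p) * g e false).
Proof.
rewrite /bern_mean -sum_powerset_prod; apply: eq_bigr => E _.
by rewrite /bern_weight -big_split /=; apply: eq_bigr => e _; case: ifP.
Qed.

Lemma bern_weight_ge0 E : 0 <= bern_weight p B E.
Proof. by apply: prodr_ge0 => e _; case: ifP; rewrite ?subr_ge0. Qed.

Lemma bern_mean1 : bern_mean p B (fun=> 1) = 1.
Proof.
have := bern_mean_prod (fun _ _ => 1).
rewrite [RHS]big1 => [H|e _]; last by rewrite !mulr1 addrC subrK.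
by rewrite -[RHS]H; apply: eq_bigr => E _; rewrite big1.
Qed.

Lemma ler_bern_mean (f g : {set T} -> R) :
  (forall E : {set T}, E \subset B -> f E <= g E) -> bern_mean p B f <= bern_mean p B g.
Proof.
move=> fg; apply: ler_sum => E; rewrite powersetE => EB.
by rewrite ler_wpM2l ?bern_weight_ge0 ?fg.
Qed.

Lemma bern_meanD (f g : {set T} -> R) :
  bern_mean p B (fun E => f E + g E) = bern_mean p B f + bern_mean p B g.
Proof. by rewrite -big_split; apply: eq_bigr => E _; rewrite mulrDr. Qed.

Lemma bern_meanZ a (f : {set T} -> R) : bern_mean p B (fun E => a * f E) = a * bern_mean p B f.
Proof. by rewrite /bern_mean mulr_sumr; apply: eq_bigr => E _; rewrite mulrCA. Qed.

Lemma bern_mean_sum (I : finType) (P : pred I) (F : I -> {set T} -> R) :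
  bern_mean p B (fun E => \sum_(i | P i) F i E) =
  \sum_(i | P i) bern_mean p B (F i).
Proof.
rewrite exchange_big; apply: eq_bigr => E _; exact: mulr_sumr.
Qed.

Lemma bern_mean_mem e :
  e \in B -> bern_mean p B (fun E => (e \in E)%:R) = p.
Proof.
move=> eB; have := bern_mean_prod (fun e' b => if e' == e then b%:R else 1).
rewrite [RHS](bigD1 e) //= eqxx mulr1 mulr0 addr0 big1 ?mulr1 => [H|e'].
  rewrite -[RHS]H; apply: eq_bigr => E _; congr (_ * _).
  by rewrite (bigD1 e) //= eqxx big1 ?mulr1 // => e' /andP[_ /negPf ->].
by case/andP=> _ /negPf ->; rewrite !mulr1 addrC subrK.
Qed.

Lemma bern_mean_card (A : {set T}) :
  A \subset B -> bern_mean p B (fun E => #|E :&: A|%:R) = p * #|A|%:R.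
Proof.
move=> /subsetP AB.
transitivity (\sum_(e in A) bern_mean p B (fun E => (e \in E)%:R)).
  rewrite -bern_mean_sum; apply: eq_bigr => E _; congr (_ * _).
  rewrite -sum1_card natr_sum (eq_bigl (fun e => (e \in A) && (e \in E))).
    by rewrite big_mkcondr; apply: eq_bigr => e _; case: ifP.
  by move=> e; rewrite inE andbC.
rewrite (eq_bigr (fun=> p)) => [|e /AB eB]; last by rewrite bern_mean_mem.
by rewrite sumr_const mulr_natr.
Qed.

Lemma bern_mean_lt_ex (f : {set T} -> R) (c : R) :
  bern_mean p B f < c -> exists2 E : {set T}, E \subset B & f E < c.
Proof.
move=> fc; have [//|nE] := pselect (exists2 E : {set T}, E \subset B & f E < c).
suff : c <= bern_mean p B f by rewrite leNgt fc.
have -> : c = bern_mean p B (fun=> c * 1) by rewrite bern_meanZ bern_mean1 mulr1.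
apply: ler_bern_mean => E EB.
by rewrite mulr1 leNgt; apply/negP => fE; apply: nE; exists E.
Qed.

End Bernoulli.

Section RandomGraph.
Variables (R : realType) (n : nat) (p : R).
Hypotheses (p_ge0 : 0 <= p) (p_le1 : p <= 1).
Local Notation graph := {set {set 'I_n}}.

Lemma gnp_probE (Q : graph -> Prop) :
  gnp_prob p Q = bern_mean p (pairs 'I_n) (fun E => `[< Q E >]%:R).
Proof.
rewrite /gnp_prob big_mkcondr; apply: eq_bigr => E _.
by case: ifP => _; rewrite ?mulr1 ?mulr0.
Qed.

Lemma gnp_prob_le (Q : graph -> Prop) (f : graph -> R) :
  (forall E : graph, E \subset pairs 'I_n -> 0 <= f E) ->
  (forall E : graph, E \subset pairs 'I_n -> Q E -> 1 <= f E) ->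
  gnp_prob p Q <= bern_mean p (pairs 'I_n) f.
Proof.
move=> f0 f1; rewrite gnp_probE; apply: ler_bern_mean => // E EB.
by case: asboolP => [/f1|_]; rewrite /= ?f0 //; apply.
Qed.

Lemma gnp_prob_mono (P Q : graph -> Prop) :
  (forall E : graph, E \subset pairs 'I_n -> P E -> Q E) -> gnp_prob p P <= gnp_prob p Q.
Proof.
move=> PQ; rewrite [leRHS]gnp_probE; apply: gnp_prob_le => E EB.
  exact: ler0n.
by move=> /(PQ _ EB) /asboolP ->.
Qed.

Lemma gnp_probC (Q : graph -> Prop) :
  gnp_prob p Q = 1 - gnp_prob p (fun E => ~ Q E).
Proof.
apply/eqP; rewrite eq_sym subr_eq !gnp_probE -bern_meanD -[X in X == _](bern_mean1 p (pairs 'I_n)).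
apply/eqP; apply: eq_bigr => E _; congr (_ * _).
by rewrite asbool_neg; case: asboolP => _ /=; rewrite ?addr0 ?add0r.
Qed.

Lemma gnp_prob_or (P Q : graph -> Prop) :
  gnp_prob p (fun E => P E \/ Q E) <= gnp_prob p P + gnp_prob p Q.
Proof.
rewrite !(gnp_probE P, gnp_probE Q) -bern_meanD; apply: gnp_prob_le => E EB.
  by rewrite addr_ge0.
by case=> /asboolP -> /=; rewrite ?lerDl ?lerDr ?ler0n.
Qed.

Lemma gnp_prob_le1 (Q : graph -> Prop) : gnp_prob p Q <= 1.
Proof.
rewrite -[leRHS](bern_mean1 p (pairs 'I_n)); apply: gnp_prob_le => E _ //; exact: ler01.
Qed.

End RandomGraph.

(* With probability more than one half, the sample U is at most twice as big as
   expected; by a Chernoff bound few vertices of Q see too little of it. *)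
Lemma exists_sparse_sample (R : realType) (V : finType) (r : rel V)
    (P Q : {set V}) (q d : R) :
  0 < q -> q <= 1 -> 28 <= q * d -> (0 < #|P|)%N -> (0 < #|Q|)%N ->
  (forall v, v \in Q -> d <= (rdeg r v P)%:R) ->
  exists U : {set V}, [/\ U \subset P, #|U|%:R <= 2 * q * #|P|%:R &
    2 * #|[set v in Q | (rdeg r v U)%:R < q * d / 4]|%:R <= #|Q|%:R :> R].
Proof.
move=> q0 q1 qd P0 Q0 hd.
have P0' : 0 < #|P|%:R :> R by rewrite ltr0n.
have Q0' : 0 < #|Q|%:R :> R by rewrite ltr0n.
(* The weights [a] and [b] make the two means in [f] equal to 1 / 4 and at most 1 / 8, so some
   sample keeps the sum, and with it each term, below 1 / 2. *)
pose a : R := (4 * q * #|P|%:R)^-1.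
pose b : R := expR (q * d / 4) / #|Q|%:R.
have a0 : 0 < a by rewrite invr_gt0 !mulr_gt0.
have b0 : 0 < b by rewrite divr_gt0 ?expR_gt0.
pose f (U : {set V}) : R :=
  a * #|U :&: P|%:R + b * \sum_(v in Q) (1 / 2) ^+ rdeg r v U.
have hv v : v \in Q -> bern_mean q P (fun U => (1 / 2) ^+ rdeg r v U) <= expR (- (q * d / 2)).
  move=> vQ.
  pose g (u : V) (c : bool) : R := if r v u && c then 1 / 2 else 1.
  have -> : bern_mean q P (fun U => (1 / 2) ^+ rdeg r v U) =
            bern_mean q P (fun U => \prod_(u in P) g u (u \in U)).
    apply: eq_bigr => U; rewrite powersetE => /subsetP UP; congr (_ * _).
    rewrite /rdeg -prodr_const big_mkcond [RHS]big_mkcond; apply: eq_bigr => u _.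
    rewrite inE /g andbC; case: (boolP (u \in U)) => [/UP ->|_] //.
    by rewrite !andbF if_same.
  rewrite bern_mean_prod; apply: (@le_trans _ _ (\prod_(u in P) (if r v u then expR (- (q / 2)) else 1))).
    apply: ler_prod => u _; rewrite /g andbT andbF; case: (r v u) => /=; last by apply/andP; split; lra.
    by have := expR_ge1Dx (- (q / 2)); lra.
  rewrite -big_mkcondr (eq_bigl (mem [set u in P | r v u])) => [|u]; last by rewrite !inE.
  rewrite prodr_const -expRM_natr ler_expR -/(rdeg r v P).
  have := hd v vQ; set k : R := _%:R => dk.
  have := ler_wpM2l (ltW q0) dk; lra.
have mf : bern_mean q P f < 1 / 2.
  rewrite bern_meanD !bern_meanZ bern_mean_card ?bern_mean_sum //.
  have s1 : a * (q * #|P|%:R) = 1 / 4 by rewrite /a; field; rewrite !gt_eqF.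
  have s2 : \sum_(v in Q) bern_mean q P (fun U => (1 / 2) ^+ rdeg r v U) <=
      #|Q|%:R * expR (- (q * d / 2)).
    by rewrite mulr_natl -sumr_const; apply: ler_sum.
  have s3 : b * (#|Q|%:R * expR (- (q * d / 2))) = expR (- (q * d / 4)).
    rewrite /b -mulrA [_^-1 * _]mulrA mulVf ?gt_eqF // mul1r -expRD.
    by congr expR; field.
  have s4 : expR (- (q * d / 4)) <= 1 / 8.
    (* The hypothesis [28 <= q * d] is calibrated for this: 1 + 28 / 4 = 8. *)
    have e1 : 8 <= expR (q * d / 4) by have := expR_ge1Dx (q * d / 4); lra.
    rewrite expRN -[leLHS]mul1r ler_pdivrMr ?expR_gt0 //; lra.
  have := ler_wpM2l (ltW b0) s2; lra.
have [U UP fU] := bern_mean_lt_ex (ltW q0) q1 mf.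
have t0 : 0 <= \sum_(v in Q) (1 / 2) ^+ rdeg r v U :> R.
  by apply: sumr_ge0 => v _; rewrite exprn_ge0.
have u0 : 0 <= a * #|U :&: P|%:R by rewrite mulr_ge0 // ltW.
exists U; split=> //.
  have : a * #|U|%:R < 1 / 2.
    move: fU; rewrite /f (setIidPl UP); have := mulr_ge0 (ltW b0) t0; lra.
  rewrite /a mulrC -ltr_pdivlMr ?invr_gt0 ?mulr_gt0 // invrK; lra.
set F := [set v in Q | _].
have s5 : #|F|%:R * expR (- (q * d / 4)) <= \sum_(v in Q) (1 / 2) ^+ rdeg r v U.
  rewrite mulr_natl -sumr_const big_mkcond [leRHS]big_mkcond; apply: ler_sum => v _.
  rewrite inE; case: (v \in Q) => //=; case: ifP => [lt|_]; last by rewrite exprn_ge0.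
  (* As 1 / 2 is at least 1 / e, a failing vertex contributes at least exp (- q d / 4). *)
  apply: (@le_trans _ _ (expR (- 1) ^+ rdeg r v U)).
    by rewrite -expRM_natr ler_expR; lra.
  rewrite lerXn2r ?nnegrE ?expR_ge0 //.
  rewrite expRN -[leLHS]mul1r ler_pdivrMr ?expR_gt0 //.
  have := expR_ge1Dx (1 : R); lra.
have s6 : b * (#|F|%:R * expR (- (q * d / 4))) = #|F|%:R / #|Q|%:R.
  rewrite /b mulrCA mulrAC -expRD subrr expR0 mul1r //.
have := ler_wpM2l (ltW b0) s5; rewrite s6 => s7.
have : #|F|%:R / #|Q|%:R < 1 / 2 :> R.
  by apply: (le_lt_trans s7); apply: le_lt_trans fU; rewrite /f lerDr.
rewrite ltr_pdivrMr //; lra.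
Qed.

(** * Cleaning up a maximum cut *)

(** Maximise the edge count between [P] and [Q] minus [m] per vertex: deleting a vertex of degree
    below [m] would increase it, and its value is positive at [(P0, Q0)], so neither set of a
    maximiser is empty. *)
Lemma exists_min_degree_pair (R : realFieldType) (V : finType) (h : rel V)
    (P0 Q0 : {set V}) (m : R) :
  symmetric h -> 0 <= m -> m * (#|P0|%:R + #|Q0|%:R) < (ec h P0 Q0)%:R ->
  exists P Q : {set V}, [/\ P \subset P0, Q \subset Q0, (0 < #|P|)%N, (0 < #|Q|)%N &
    (forall u, u \in P -> m <= (rdeg h u Q)%:R) /\
    (forall v, v \in Q -> m <= (rdeg h v P)%:R)].
Proof.
move=> hsym m0 big.
pose f (PQ : {set V} * {set V}) : R :=
  (ec h PQ.1 PQ.2)%:R - m * (#|PQ.1|%:R + #|PQ.2|%:R).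
pose c (PQ : {set V} * {set V}) := (PQ.1 \subset P0) && (PQ.2 \subset Q0).
have c0 : c (P0, Q0) by rewrite /c /= !subxx.
have [[P Q] /andP[/= PP QQ] maxf] := @Order.TotalTheory.arg_maxP _ R _ (P0, Q0) c f c0.
have fpos : m * (#|P|%:R + #|Q|%:R) < (ec h P Q)%:R.
  by have := maxf _ c0; rewrite /f /= => H; lra.
have nn (A : {set V}) : 0 <= #|A|%:R :> R by rewrite ler0n.
have ecpos : (0 < ec h P Q)%N.
  rewrite -(ltr_nat R); apply: le_lt_trans fpos.
  by rewrite mulr_ge0 // addr_ge0 // nn.
exists P, Q; split => //.
- by rewrite lt0n cards_eq0; apply: contraTneq ecpos => ->; rewrite /ec big_set0.
- rewrite lt0n cards_eq0; apply: contraTneq ecpos => ->.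
  by rewrite ec_sym // /ec big_set0.
split=> [u uP|v vQ].
  have := maxf (P :\ u, Q); rewrite /c /= QQ andbT => /(_ (subset_trans (subsetDl _ _) PP)).
  rewrite /f /= /ec (big_setD1 u uP) /= natrD (cardsD1 u P) uP natrD /=; lra.
have := maxf (P, Q :\ v); rewrite /c /= PP => /(_ (subset_trans (subsetDl _ _) QQ)).
rewrite /f /= ![ec h P _]ec_sym // /ec (big_setD1 v vQ) /= natrD.
by rewrite (cardsD1 v Q) vQ natrD /=; lra.
Qed.

(** * Maximum cuts *)

Section MaxCut.
Variables (V : finType) (h : rel V).
Hypotheses (hsym : symmetric h) (hirr : irreflexive h).

(** Ordered pairs are counted, so this is twice the number of inner edges. *)
Definition inside (X : {set V}) : nat := ec h X X + ec h (~: X) (~: X).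

Lemma insideC X : inside (~: X) = inside X.
Proof. by rewrite /inside setCK addnC. Qed.

Lemma ec_remove (X : {set V}) x :
  x \in X -> ec h X X = (2 * rdeg h x X + ec h (X :\ x) (X :\ x))%N.
Proof.
move=> xX; have e1 : rdeg h x (X :\ x) = rdeg h x X.
  congr #|pred_of_set _|; apply/setP => y; rewrite !inE.
  by have [->|_] := eqVneq y x; rewrite //= hirr andbF.
rewrite {1}/ec (big_setD1 x xX) /= -/(ec h (X :\ x) X) ec_sym //.
by rewrite {1}/ec (big_setD1 x xX) /= e1 -/(ec _ _ _) addnA addnn mul2n.
Qed.

Lemma inside_flip (X : {set V}) x : x \in X ->
  (inside X + 2 * rdeg h x (~: X) = inside (X :\ x) + 2 * rdeg h x X)%N.
Proof.
move=> xX; rewrite /inside (ec_remove xX).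
have xC : x \in ~: (X :\ x) by rewrite !inE eqxx.
have e : ~: (X :\ x) :\ x = ~: X.
  apply/setP => y; rewrite !inE.
  by have [->|_] := eqVneq y x; rewrite //= xX.
rewrite (ec_remove xC) e (rdegID h x (~: (X :\ x)) [set x]).
have -> : rdeg h x (~: (X :\ x) :&: [set x]) = 0%N.
  by apply: rdeg0 => y; rewrite !inE => /andP[_ /eqP ->]; rewrite hirr.
by rewrite e add0n; lia.
Qed.

Lemma exists_max_cut : exists X : {set V},
  (forall Y, (inside X <= inside Y)%N) /\
  (forall x, x \in X -> (rdeg h x X <= rdeg h x (~: X))%N) /\
  (forall x, x \notin X -> (rdeg h x (~: X) <= rdeg h x X)%N).
Proof.
have [X _ minX] := arg_minnP inside (isT : xpredT (set0 : {set V})).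
have half Y : (forall Z, (inside Y <= inside Z)%N) -> forall x, x \in Y ->
    (rdeg h x Y <= rdeg h x (~: Y))%N.
  by move=> minY x xY; have := inside_flip xY; have := minY (Y :\ x); lia.
exists X; split; first by move=> Y; apply: minX.
split=> [x xX|x xX]; first by apply: half => // Y; apply: minX.
rewrite -{2}[X]setCK; apply: half; last by rewrite inE.
by move=> Z; rewrite insideC; apply: minX.
Qed.

End MaxCut.

(** * Few edges inside one side of a cut, by triangle-freeness and sampling *)

Section Cleaning.
Variables (R : realType) (V : finType) (g h : rel V) (p eps C q d : R).
Local Notation n := (#|V|%:R : R).
Local Notation D := (p * n).
Hypotheses (p_gt0 : 0 < p) (p_le1 : p <= 1) (n_gt0 : 0 < n) (C_ge0 : 0 <= C).
Hypotheses (hsym : symmetric h) (hg : forall x y, h x y -> g x y).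
Hypothesis tri : forall x y z, h x y -> h y z -> h x z -> False.

(** The target of [v] varies with [v], but only through the edges of [h'] at [U]; the many possible
    choices of these edges are paid for by the error term proportional to p' n #|U|. *)
Definition via_regular (g' h' : rel V) (p' eps' C' : R) := forall U Q Y : {set V},
  (\sum_(v in Q :\: U) rdeg g' v ((Y :\: via h' U v) :\: U))%:R <=
  p' * (\sum_(v in Q :\: U) #|(Y :\: via h' U v) :\: U|)%:R + eps' * (p' * n) * #|Q|%:R
  + C' * (p' * n * #|U|%:R + n).

Lemma via_regular_upper (p' eps' C' : R) :
  via_regular g h p' eps' C' -> upper_regular g p' eps' C'.
Proof.
move=> M A B; have := M set0 A B; rewrite cards0 mulr0 add0r setD0.
have e (F : {set V} -> V -> nat) : (\sum_(v in A) F ((B :\: via h set0 v) :\: set0) v =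
    \sum_(v in A) F B v)%N by apply: eq_bigr => v _; rewrite via0 !setD0.
rewrite (e (fun S v => rdeg g v S)) (e (fun S v => #|S|)) sum_nat_const natrM.
by rewrite mulrA.
Qed.

Hypothesis Mg : via_regular g h p eps C.
Hypotheses (eps_gt0 : 0 < eps) (q_gt0 : 0 < q) (q_le : q <= 1 / 8).
Hypotheses (Cq : 8 * C * q <= eps) (qd : 28 <= q * d) (Cd : 4 * C <= eps * p * (q * d)).

Let D_gt0 : 0 < D. Proof. exact: mulr_gt0. Qed.
Let Jg : upper_regular g p eps C := via_regular_upper Mg.

(** A sparse sample [U] of [P] is still seen at least [q * d / 4] times by many [v] in [Q]. The
    neighbours in [Y] of those sampled vertices fill almost [b * n] of [Y], and [v] has no neighbour
    among them. So the [b' * D] edges from [v] to [Y] are squeezed into about [(y - b) * n]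
    vertices, too few for [via_regular]. *)
Lemma dense_pair_absurd (P Q Y : {set V}) (b b' y : R) :
  P :&: Y = set0 -> (#|P| <= #|Q|)%N -> (0 < #|P|)%N -> d <= #|Q|%:R ->
  (forall v, v \in Q -> d <= (rdeg h v P)%:R) ->
  (forall u, u \in P -> b * D <= (rdeg h u Y)%:R) ->
  (forall v, v \in Q -> b' * D <= (rdeg h v Y)%:R) ->
  #|Y|%:R <= y * n -> y + 5 * eps < b + b' -> False.
Proof.
move=> PY PQ P0 dQ hd hb hb' Yn bb.
have Q0 : (0 < #|Q|)%N := leq_trans P0 PQ.
have [n0 c0 qle] := And3 n_gt0 C_ge0 q_le; have [e0 qpos] := conj eps_gt0 q_gt0.
have qd' := qd; have Cd' := Cd; have Cq' := Cq.
have q1 : q <= 1 by lra.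
have [U [UP Us fail]] := exists_sparse_sample q_gt0 q1 qd P0 Q0 hd.
have Q0' : 0 < #|Q|%:R :> R by rewrite ltr0n.
pose Q1 := [set v in Q | q * d / 4 <= (rdeg h v U)%:R] :\: U.
have PQ' : #|P|%:R <= #|Q|%:R :> R by rewrite ler_nat.
have Us' : #|U|%:R <= 2 * q * #|Q|%:R.
  by apply: (le_trans Us); rewrite ler_wpM2l // mulr_ge0 // ltW.
(* At most half of [Q] fails, and [#|U|] is at most a quarter of [#|Q|]. *)
have Q1s : #|Q|%:R <= 4 * #|Q1|%:R :> R.
  have : Q \subset [set v in Q | (rdeg h v U)%:R < q * d / 4] :|: (Q1 :|: U).
    apply/subsetP => v vQ; rewrite in_setU in_setU in_setD !inE vQ /=.
    by case: (v \in U); rewrite ?orbT //= orbF ltNge; case: (_ <= _).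
  move=> /subset_leq_card /leq_trans/(_ (card_setU_le _ _)) => c1.
  have c2 := leq_trans c1 (leq_add (leqnn _) (card_setU_le _ _)).
  move: c2; rewrite -(ler_nat R) !natrD => c2.
  have := ler_wpM2r (ltW Q0') q_le; lra.
pose T v := via h U v :&: Y.
have Ts v : v \in Q1 -> (b - 2 * eps) * n <= #|T v|%:R.
  rewrite !inE => /andP[_ /andP[vQ vU]].
  pose A := [set u in U | h v u].
  have hA u : u \in A -> b * D <= (rdeg g u (T v))%:R.
    rewrite inE => /andP[uU hvu]; apply: (le_trans (hb _ (subsetP UP _ uU))).
    rewrite ler_nat; apply: (@leq_trans (rdeg h u (T v))); last first.
      by apply: rdeg_le => z _; apply: hg.
    apply: rdeg_sub => z zY huz; rewrite in_setI zY andbT.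
    by apply/viaP; exists u; rewrite ?huz // hsym hvu.
  have := ec_ge hA; have := Jg A (T v).
  have -> : #|A| = rdeg h v U by [].
  set a : R := (rdeg h v U)%:R; move: vU; rewrite -/a => ad h1 h2.
  have a0 : 0 < a by apply: lt_le_trans ad; lra.
  have h3 : C * n <= eps * p * a * n.
    rewrite ler_wpM2r ?(ltW n_gt0) //.
    have k : 0 < eps * p by rewrite mulr_gt0.
    by have := ler_wpM2l (ltW k) ad; lra.
  have k : 0 < p * a by rewrite mulr_gt0.
  rewrite -(ler_pM2l k); lra.
have Q1U : Q1 :\: U = Q1.
  by apply/setP => v; rewrite !inE; case: (v \in U).
have := Mg U Q1 Y; rewrite Q1U.
have lo : #|Q1|%:R * (b' * D) <= (\sum_(v in Q1) rdeg g v ((Y :\: via h U v) :\: U))%:R.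
  rewrite natr_sum mulr_natl -sumr_const; apply: ler_sum => v.
  rewrite !inE => /andP[_ /andP[vQ _]]; apply: (le_trans (hb' v vQ)); rewrite ler_nat.
  apply: (@leq_trans (rdeg h v ((Y :\: via h U v) :\: U))); last first.
    by apply: rdeg_le => z _; apply: hg.
  apply: rdeg_sub => z zY hvz; rewrite !in_setD zY andbT; apply/andP; split.
    apply/negP => zU; have := subsetP UP _ zU => zP.
    by have : z \in P :&: Y; [rewrite in_setI zP zY | rewrite PY inE].
  by apply/viaP => -[u _ /andP[huv huz]]; apply: (tri huv hvz huz).
have hi : (\sum_(v in Q1) #|(Y :\: via h U v) :\: U|)%:R <= #|Q1|%:R * ((y - b + 2 * eps) * n).
  rewrite natr_sum mulr_natl -sumr_const; apply: ler_sum => v /Ts Tv.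
  apply: (@le_trans _ _ #|Y :\: via h U v|%:R).
    by rewrite ler_nat subset_leq_card // subsetDl.
  have : #|Y|%:R = #|T v|%:R + #|Y :\: via h U v|%:R :> R.
    by rewrite -natrD /T setIC cardsID.
  lra.
have n1 : 0 < #|Q1|%:R :> R by lra.
have h1 := ler_wpM2l (ltW p_gt0) hi.
have h2 : C * (D * #|U|%:R) <= eps * (D * #|Q1|%:R).
  have k : 0 <= C * D by rewrite mulr_ge0 // ltW.
  have k' : 0 < D * #|Q1|%:R by rewrite mulr_gt0.
  have a1 : C * D * #|U|%:R <= C * D * (8 * q * #|Q1|%:R).
    by rewrite ler_wpM2l //; have := ler_wpM2l (ltW q_gt0) Q1s; lra.
  by have := ler_wpM2r (ltW k') Cq; lra.
have h3 : C * n <= eps * (D * #|Q1|%:R).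
  have k : 0 < eps * p by rewrite mulr_gt0.
  have a1 : 4 * C <= eps * p * #|Q|%:R.
    apply: (le_trans Cd); rewrite ler_wpM2l ?(ltW k) // (le_trans _ dQ) //.
    have d0 : 0 < d by rewrite -(pmulr_rgt0 _ q_gt0); lra.
    by have := ler_wpM2r (ltW d0) q1; lra.
  have a2 := ler_wpM2l (ltW k) Q1s.
  have a3 : C <= eps * p * #|Q1|%:R by lra.
  by have := ler_wpM2r (ltW n_gt0) a3; lra.
move=> M; have k' : 0 < D * #|Q1|%:R by rewrite mulr_gt0.
(* Two [eps] come from the size of [T v], and one from each of the three error terms of
   [via_regular]. *)
have : (b' * (D * #|Q1|%:R) <= (y - b + 5 * eps) * (D * #|Q1|%:R)).
  by lra.
by rewrite ler_pM2r //; lra.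
Qed.

(** Otherwise some subpair has minimum degree [d], and the larger of its two sides plays [Q] in
    [dense_pair_absurd]. *)
Lemma few_edges_between (P0 Q0 Y : {set V}) (b b' y : R) :
  P0 :&: Y = set0 -> Q0 :&: Y = set0 ->
  (forall u, u \in P0 -> b * D <= (rdeg h u Y)%:R) ->
  (forall v, v \in Q0 -> b' * D <= (rdeg h v Y)%:R) ->
  #|Y|%:R <= y * n -> y + 5 * eps < b + b' ->
  (ec h P0 Q0)%:R <= 2 * d * n.
Proof.
move=> PY QY hb hb' Yn bb; rewrite leNgt; apply/negP => big.
have d0 : 0 < d by rewrite -(pmulr_rgt0 _ q_gt0); have := qd; lra.
have big' : d * (#|P0|%:R + #|Q0|%:R) < (ec h P0 Q0)%:R.
  apply: le_lt_trans big; rewrite [2 * d]mulrC -mulrA ler_wpM2l ?(ltW d0) //.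
  by have := card_le_n R P0; have := card_le_n R Q0; lra.
have [P [Q [PP QQ Pn Qn [dP dQ]]]] := exists_min_degree_pair hsym (ltW d0) big'.
have sub0 (A B : {set V}) : A \subset B -> B :&: Y = set0 -> A :&: Y = set0.
  by move=> AB BY; apply/eqP; rewrite -subset0 -BY setSI.
have deg_le x (A : {set V}) : (rdeg h x A)%:R <= #|A|%:R :> R.
  by rewrite ler_nat subset_leq_card //; apply/subsetP => z; rewrite inE => /andP[].
have [u uP] : exists u, u \in P by apply/set0Pn; rewrite -card_gt0.
have [v vQ] : exists v, v \in Q by apply/set0Pn; rewrite -card_gt0.
have [PQ|/ltnW QP] := leqP #|P| #|Q|.
  apply: (dense_pair_absurd (sub0 _ _ PP PY) PQ Pn (le_trans (dP _ uP) (deg_le _ _)) dQ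
    (fun x xP => hb x (subsetP PP _ xP)) (fun x xQ => hb' x (subsetP QQ _ xQ)) Yn bb).
apply: (dense_pair_absurd (sub0 _ _ QQ QY) QP Qn (le_trans (dQ _ vQ) (deg_le _ _)) dP
    (fun x xQ => hb' x (subsetP QQ _ xQ)) (fun x xP => hb x (subsetP PP _ xP)) Yn).
by rewrite [b' + b]addrC.
Qed.

Variables (theta zeta h0 : R).
Hypotheses (theta_gt0 : 0 < theta) (h0_big : 2 < 5 * (h0 - 4 * theta)).
Hypotheses (eps_le : eps <= theta / 4) (zeta_le : 4 * zeta <= theta ^+ 2).
Hypothesis hdeg : forall x, h0 * D <= (rdeg h x setT)%:R.

(** Edges meeting [Lo] are bounded by [few_edges_between]: h0 / 2 + (h0 - theta) exceeds (1 - h0 +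
    theta) + 5 eps because h0 is above 2 / 5 by more than 4 theta. The set [Hi] is so small that, up
    to [C * n], at most half of the [theta * D] inner edges guaranteed per vertex can stay inside
    it; the edges within [Hi] are therefore charged to those between [Hi] and [Lo]. *)
Lemma few_edges_inside (X : {set V}) :
  (forall x, x \in X -> (rdeg h x X <= rdeg h x (~: X))%N) ->
  (ec h X X)%:R <= zeta * (D * n) -> #|~: X|%:R <= (1 - h0 + theta) * n ->
  (ec h X X)%:R <= (6 * d + 2 * C) * n.
Proof.
move=> half Xz Ys.
pose Lo := [set x in X | (rdeg h x X)%:R < theta * D].
pose Hi := X :\: Lo.
have [th n0 c0] := And3 theta_gt0 n_gt0 C_ge0; have ep := eps_le.
have HiX : Hi \subset X by apply: subsetDl.
have LoX : Lo \subset X by apply/subsetP => x; rewrite inE => /andP[].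
have disjY (A : {set V}) : A \subset X -> A :&: ~: X = set0.
  by move=> AX; rewrite -setDE; apply/eqP; rewrite setD_eq0.
have dsum x : h0 * D <= (rdeg h x X)%:R + (rdeg h x (~: X))%:R.
  by rewrite -natrD -rdegC.
have XLo : (ec h X Lo)%:R <= 2 * d * n.
  apply: (few_edges_between (b := h0 / 2) (b' := h0 - theta) (disjY _ (subxx _)) (disjY _ LoX) _ _ Ys).
  - move=> u uX; have := dsum u; have := half u uX; rewrite -(ler_nat R); lra.
  - by move=> v; rewrite inE => /andP[_ lo]; have := dsum v; lra.
  - by have := h0_big; have := eps_le; lra.
have hiX : #|Hi|%:R * (theta * D) <= (ec h Hi X)%:R.
  apply: ec_ge => x; rewrite !inE negb_and => /andP[+ xX].
  by rewrite xX -leNgt.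
have splitX A : ec h A X = (ec h A Lo + ec h A Hi)%N.
  rewrite (ec_sym _ X hsym) (ecID h X Lo) (setIidPr LoX).
  by rewrite (ec_sym Lo A hsym) (ec_sym _ A hsym).
have HiLo : (ec h Hi Lo)%:R <= 2 * d * n.
  by apply: le_trans XLo; rewrite ler_nat ecS.
have Hi_small : #|Hi|%:R <= theta / 4 * n.
  have k : 0 < theta * D by rewrite mulr_gt0.
  rewrite -(ler_pM2r k); apply: (le_trans hiX).
  apply: (@le_trans _ _ (ec h X X)%:R); first by rewrite ler_nat ecS.
  apply: (le_trans Xz); have Dn := mulr_gt0 D_gt0 n_gt0.
  by have := ler_wpM2r (ltW Dn) zeta_le; lra.
have JH := Jg Hi Hi.
have gh : (ec h Hi Hi)%:R <= (ec g Hi Hi)%:R :> R by rewrite ler_nat ec_le.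
have Hi0 : 0 <= #|Hi|%:R :> R by rewrite ler0n.
have j1 : p * #|Hi|%:R * #|Hi|%:R <= theta / 4 * (D * #|Hi|%:R).
  by have := ler_wpM2l (mulr_ge0 (ltW p_gt0) Hi0) Hi_small; lra.
have j2 : eps * D * #|Hi|%:R <= theta / 4 * (D * #|Hi|%:R).
  by have := ler_wpM2r (mulr_ge0 (ltW D_gt0) Hi0) eps_le; lra.
have HX := splitX Hi.
have LoHi : (ec h Lo Hi)%:R <= 2 * d * n by rewrite ec_sym.
have XX : ec h X X = (ec h X Lo + (ec h Lo Hi + ec h Hi Hi))%N.
  by rewrite splitX [ec h X Hi](ecID h X Lo) (setIidPr LoX).
(* The count within [Hi] is at most (2 d + 2 C) n, and the pairs meeting [Lo] add 4 d n. *)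
move: hiX; rewrite HX XX !natrD; lra.
Qed.

End Cleaning.

(** * Upper tails in the random graph *)

Section EdgeCounting.
Variables (V : finType).
Implicit Types (G E : {set {set V}}) (T : V -> {set V}) (U : {set V}).

(** For a pair [e] with end [v], [e :\ v] is the singleton of the other end. *)
Definition hits T (e : {set V}) : nat := #|[set v in e | e :\ v \subset T v]|.

Lemma adj_sym G x y : adj G x y = adj G y x.
Proof. by rewrite /adj setUC. Qed.

Lemma adj_neq G x y : G \subset pairs V -> adj G x y -> x != y.
Proof.
move=> /subsetP GV /GV; rewrite inE cards2.
by case: (x != y).
Qed.

Lemma rdeg_adjE G v (B : {set V}) : G \subset pairs V ->
  rdeg (adj G) v B = #|[set e in G | (v \in e) && (e :\ v \subset B)]|.
Proof.
move=> GV; have set2D (x y : V) : x != y -> [set x; y] :\ x = [set y].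
  move=> xy; rewrite setU1K // !inE //.
rewrite /rdeg -(card_in_imset (f := fun y => [set v; y])); last first.
  move=> y z; rewrite !inE => /andP[_ vy] /andP[_ vz] e.
  apply/set1P; rewrite -(set2D _ _ (adj_neq GV vz)) -e.
  by rewrite set2D ?set11 ?(adj_neq GV vy).
congr #|pred_of_set _|; apply/setP => e; apply/imsetP/idP.
  move=> [y]; rewrite inE => /andP[yB vy] ->; rewrite !inE eqxx /=.
  by rewrite set2D ?(adj_neq GV vy) // sub1set yB andbT.
rewrite inE => /and3P[eG ve eB].
have /cards1P[y ey] : #|e :\ v| == 1%N.
  have := subsetP GV _ eG; rewrite inE (cardsD1 v) ve add1n => /eqP [->]; by [].
have eE : e = [set v; y] by rewrite -(setD1K ve) ey.
exists y => //; rewrite inE /adj -eE eG andbT.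
by apply: (subsetP eB); rewrite ey set11.
Qed.

Lemma sum_rdeg_adj G T : G \subset pairs V ->
  (\sum_v rdeg (adj G) v (T v) = \sum_(e in G) hits T e)%N.
Proof.
move=> GV; under eq_bigr => v _ do rewrite rdeg_adjE // -sum1dep_card.
under [RHS]eq_bigr => e _ do rewrite /hits -sum1dep_card.
rewrite (exchange_big_dep (fun e => e \in G)) /=; last by move=> v e _ /andP[].
by apply: eq_bigr => e eG; apply: eq_bigl => v; rewrite eG.
Qed.

Lemma sum_hits_pairs T : (\sum_(e in pairs V) hits T e <= \sum_v #|T v|)%N.
Proof.
rewrite -sum_rdeg_adj //; apply: leq_sum => v _.
by apply: subset_leq_card; apply/subsetP => y; rewrite inE => /andP[].
Qed.

Lemma hits_le2 T e : e \in pairs V -> (hits T e <= 2)%N.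
Proof.
rewrite inE => /eqP <-; apply: subset_leq_card.
by apply/subsetP => y; rewrite inE => /andP[].
Qed.

Lemma handshake G : G \subset pairs V ->
  (\sum_v rdeg (adj G) v setT = 2 * #|G|)%N.
Proof.
move=> GV; rewrite (sum_rdeg_adj (fun=> setT)) // (eq_bigr (fun=> 2%N)).
  by rewrite sum_nat_const mulnC.
move=> e eG; have := subsetP GV _ eG; rewrite inE => /eqP <-.
by rewrite /hits; congr #|pred_of_set _|; apply/setP => v; rewrite inE subsetT andbT.
Qed.

Definition touch U : {set {set V}} := [set e in pairs V | ~~ [disjoint e & U]].

Lemma card_touch U : (#|touch U| <= #|U| * #|V|)%N.
Proof.
rewrite -cardsT -cardsX.
apply: leq_trans (leq_imset_card (fun xy => [set xy.1; xy.2]) _).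
apply: subset_leq_card; apply/subsetP => e; rewrite inE => /andP[eV].
rewrite -setI_eq0 => /set0Pn[u]; rewrite inE => /andP[ue uU].
have /cards1P[y ey] : #|e :\ u| == 1%N.
  by move: eV; rewrite inE (cardsD1 u) ue add1n => /eqP [->].
by apply/imsetP; exists (u, y); rewrite ?inE ?uU //= -ey setD1K.
Qed.

(** The pairs counted by this family avoid [touch U], hence are independent of the edges that
    determine the family. *)
Definition off U T v : {set V} := if v \in U then set0 else T v :\: U.

Lemma hits_touch U T e : e \in touch U -> hits (off U T) e = 0%N.
Proof.
rewrite inE => /andP[eV].
rewrite -setI_eq0 => /set0Pn[u]; rewrite inE => /andP[ue uU].
apply/eqP; rewrite cards_eq0; apply/eqP/setP => v; rewrite !inE.
apply/negbTE/negP => /andP[ve]; rewrite /off; case: ifPn => [vU|vU].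
  rewrite subset0 => /eqP ev; move: eV.
  by rewrite inE (cardsD1 v) ve ev cards0.
move=> /subsetP/(_ u); rewrite !inE ue uU andbT /= => H.
suff : u != v by move/H.
by apply: contraNneq vU => <-.
Qed.

End EdgeCounting.

Section UpperTails.
Variables (R : realType) (n : nat) (p : R).
Hypotheses (p_ge0 : 0 <= p) (p_le1 : p <= 1).
Local Notation V := 'I_n.
Local Notation graph := {set {set V}}.
Local Notation mean := (bern_mean p (pairs V)).

Lemma expR_le_quad (x : R) : 0 <= x -> x <= 1 / 2 -> expR x <= 1 + x + 2 * x ^+ 2.
Proof.
move=> x0 x1.
have h1 : 1 - x <= expR (- x) by have := expR_ge1Dx (- x); lra.
have h2 : expR (- x) * expR x = 1 by rewrite -expRD addNr expR0.
have h3 := expR_gt0 x.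
have h4 : (1 - x) * expR x <= 1 by rewrite -[leRHS]h2 ler_pM2r.
have h5 : 1 <= (1 - x) * (1 + x + 2 * x ^+ 2).
  have -> : (1 - x) * (1 + x + 2 * x ^+ 2) = 1 + x ^+ 2 * (1 - 2 * x) by ring.
  by rewrite lerDl mulr_ge0 ?sqr_ge0 //; lra.
have h6 : (1 - x) * expR x <= (1 - x) * (1 + x + 2 * x ^+ 2) by lra.
rewrite -(@ler_pM2l _ (1 - x)); lra.
Qed.

Definition arcs (T : V -> {set V}) (G : graph) : nat :=
  \sum_v rdeg (adj G) v (T v).

(** The moment factors over pairs. A pair of [E1] is never hit and contributes exactly [p]; any
    other pair has at most two hits, so its exponent is at most 1 / 2 and [expR_le_quad] applies. *)
Lemma expR_moment (l : R) (T : V -> {set V}) (E1 : graph) :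
  0 <= l -> l <= 1 / 4 -> E1 \subset pairs V ->
  (forall e, e \in E1 -> hits T e = 0%N) ->
  mean (fun G => (E1 \subset G)%:R * expR (l * (arcs T G)%:R)) <=
  (\prod_(e in pairs V) (if e \in E1 then p else 1)) *
  expR (p * (l + 4 * l ^+ 2) * (\sum_v #|T v|)%:R).
Proof.
move=> l0 l1 /subsetP E1V hE1.
set g := fun (e : {set V}) (b : bool) =>
  (if e \in E1 then b%:R else 1) * (if b then expR (l * (hits T e)%:R) else 1).
have -> : mean (fun G => (E1 \subset G)%:R * expR (l * (arcs T G)%:R)) =
          mean (fun G => \prod_(e in pairs V) g e (e \in G)).
  apply: eq_bigr => G; rewrite powersetE => GV; congr (_ * _).
  rewrite big_split /=; congr (_ * _).
    have [/subsetP E1G|/subsetPn[e eE eG]] := boolP (E1 \subset G).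
      by rewrite big1 // => e _; case: ifP => // /E1G ->.
    by rewrite (bigD1 e) ?E1V //= eE (negPf eG) mul0r.
  rewrite /arcs sum_rdeg_adj // natr_sum mulr_sumr expR_sum.
  rewrite [RHS]big_mkcond [LHS]big_mkcond; apply: eq_bigr => e _ /=.
  by case: (boolP (e \in G)) => [/(subsetP GV) ->|_] //; case: ifP.
rewrite bern_mean_prod.
have key (e : {set V}) : e \in pairs V ->
    0 <= p * g e true + (1 - p) * g e false <=
    (if e \in E1 then p else 1) * expR (p * (l + 4 * l ^+ 2) * (hits T e)%:R).
  move=> eV; rewrite /g; have ht := hits_le2 T eV.
  case: ifP => eE.
    by rewrite (hE1 _ eE) /= mulr0n !mulr0 expR0 !mul0r !mulr1 mulr0 addr0 p_ge0 lexx.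
  rewrite !mulr1 !mul1r; set k : R := (hits T e)%:R.
  have k0 : 0 <= k by rewrite ler0n.
  have k2 : k <= 2 by rewrite /k (ler_nat R _ 2).
  have hk : k ^+ 2 <= 2 * k by rewrite expr2 ler_wpM2r.
  have lk : l * k <= 1 / 2 by nra.
  have lk0 : 0 <= l * k by rewrite mulr_ge0.
  have e1 := expR_le_quad lk0 lk.
  have e0 := expR_gt0 (l * k).
  apply/andP; split; first by rewrite addr_ge0 // ?mulr_ge0 ?subr_ge0 // ltW.
  apply: le_trans (expR_ge1Dx _).
  have e2 : (l * k) ^+ 2 <= 2 * l ^+ 2 * k.
    by rewrite exprMn; have := ler_wpM2l (sqr_ge0 l) hk; lra.
  have e3 : p * expR (l * k) <= p * (1 + l * k + 4 * l ^+ 2 * k).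
    by rewrite ler_wpM2l //; lra.
  lra.
apply: (@le_trans _ _ (\prod_(e in pairs V) ((if e \in E1 then p else 1) *
    expR (p * (l + 4 * l ^+ 2) * (hits T e)%:R)))).
  by apply: ler_prod => e /key.
rewrite big_split /= ler_wpM2l //; first by apply: prodr_ge0 => e _; case: ifP.
rewrite -expR_sum ler_expR -mulr_sumr ler_wpM2l //.
  by rewrite mulr_ge0 // addr_ge0 // mulr_ge0 // sqr_ge0.
by rewrite -natr_sum ler_nat sum_hits_pairs.
Qed.

Definition supp (T : V -> {set V}) : {set V} := [set v | T v != set0].

Lemma sum_card_supp (T : V -> {set V}) : (\sum_v #|T v| <= #|supp T| * n)%N.
Proof.
rewrite (bigID (mem (supp T))) /= [X in (_ + X)%N]big1 ?addn0.
  rewrite -sum_nat_const; apply: leq_sum => v _.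
  by rewrite -[leqRHS](card_ord n) max_card.
by move=> v; rewrite inE negbK => /eqP ->; rewrite cards0.
Qed.

(* The family T may depend on the part H' of a subgraph that meets U: there are
   too many candidates for H' for a plain union bound, but the candidates
   contained in G have expected number (1 + p) ^ #|touch U|, and the edges
   avoiding U are independent of them. *)
Lemma dependent_upper_tail (A : finType) (T : {set V} -> graph -> A -> V -> {set V})
    (eps L : R) :
  0 < eps -> eps <= 1 -> #|A|%:R <= expR L ->
  gnp_prob p (fun G : graph => exists U a (H : graph), H \subset G /\
     let T' := off U (T U (H :&: touch U) a) in
     p * (\sum_v #|T' v|)%:R + eps * p * n%:R * #|supp T'|%:R
       + 8 / eps * (p * n%:R * #|U|%:R + 2 * n%:R + L) < (arcs T' G)%:R)
  <= expR (- n%:R).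
Proof.
move=> eps0 eps1 AL.
(* Then [l * (8 / eps)] is 1, and [4 * l ^+ 2 <= eps * l] lets the term with the support absorb the
   second-order part of the moment. *)
pose l := eps / 8.
have l0 : 0 <= l by rewrite /l; lra.
have l1 : l <= 1 / 4 by rewrite /l; lra.
pose T' U E1 a := off U (T U E1 a).
pose thr U E1 a := p * (\sum_v #|T' U E1 a v|)%:R + eps * p * n%:R * #|supp (T' U E1 a)|%:R
       + 8 / eps * (p * n%:R * #|U|%:R + 2 * n%:R + L).
(* Chernoff weights summed over all [U], [a] and all possible values [E1] of [H :&: touch U]: on the
   bad event one summand is at least 1. *)
pose f (G : graph) := \sum_(U : {set V}) \sum_(a : A) \sum_(E1 in powerset (touch U))
  (expR (- (l * thr U E1 a)) *
    ((E1 \subset G)%:R * expR (l * (arcs (T' U E1 a) G)%:R))).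
have term0 U a (E1 G : graph) : 0 <= expR (- (l * thr U E1 a)) *
    ((E1 \subset G)%:R * expR (l * (arcs (T' U E1 a) G)%:R)).
  by rewrite mulr_ge0 ?mulr_ge0 ?ler0n // ltW // expR_gt0.
apply: le_trans (gnp_prob_le (f := f) p_ge0 p_le1 _ _) _.
- by move=> G _; do 3![apply: sumr_ge0 => ? _]; apply: term0.
- move=> G GV [U [a [H [HG lt]]]].
  rewrite /f (bigD1 U) //= (bigD1 a) //= (bigD1 (H :&: touch U)) /=; last first.
    by rewrite powersetE subsetIr.
  rewrite (subset_trans (subsetIl _ _) HG) mul1r -expRD -!addrA.
  rewrite -[leLHS]addr0 lerD //; last first.
    by rewrite !addr_ge0 //; do ?[apply: sumr_ge0 => ? _]; apply: term0.
  rewrite -[leLHS]expR0 ler_expR addrC subr_ge0 ler_wpM2l //.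
  exact: ltW.
rewrite /f bern_mean_sum.
have bound U a (E1 : graph) : E1 \in powerset (touch U) ->
   mean (fun G => expR (- (l * thr U E1 a)) *
    ((E1 \subset G)%:R * expR (l * (arcs (T' U E1 a) G)%:R))) <=
   expR (- (p * n%:R * #|U|%:R + 2 * n%:R + L)) *
     \prod_(e in touch U) (if e \in E1 then p else 1).
  rewrite powersetE => E1t.
  have E1V : E1 \subset pairs V.
    by apply: subset_trans E1t _; apply/subsetP => e; rewrite inE => /andP[].
  rewrite bern_meanZ.
  apply: le_trans (ler_wpM2l (ltW (expR_gt0 _)) (expR_moment l0 l1 E1V _)) _.
    by move=> e /(subsetP E1t) /hits_touch ->.
  rewrite mulrCA mulrC -expRD; apply: ler_pM.
  - by rewrite ltW // expR_gt0.
  - by apply: prodr_ge0 => e _; case: ifP.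
  - rewrite ler_expR /thr.
    have := sum_card_supp (T' U E1 a).
    rewrite -(ler_nat R) natrM.
    set S : R := (\sum_v _)%:R; set q : R := #|supp _|%:R.
    set Z := p * n%:R * _ + _ + _ => Sq.
    have -> : l * (p * S + eps * p * n%:R * q + 8 / eps * Z) =
              l * p * S + eps * l * (p * (q * n%:R)) + Z.
      by rewrite /l; field; rewrite gt_eqF.
    have S0 : 0 <= S by rewrite ler0n.
    have h : p * S <= p * (q * n%:R) by rewrite ler_wpM2l.
    have h1 : 4 * l ^+ 2 * (p * S) <= 4 * l ^+ 2 * (p * (q * n%:R)).
      by rewrite ler_wpM2l // mulr_ge0 // sqr_ge0.
    have h2 : 0 <= p * (q * n%:R) by rewrite !mulr_ge0 // ler0n.
    have h3 : 4 * l ^+ 2 <= eps * l by rewrite /l; nra.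
    have h4 := ler_wpM2r h2 h3.
    lra.
  - rewrite [leLHS]big_mkcond [leRHS]big_mkcond; apply: ler_prod => e _.
    case: (boolP (e \in E1)) => [eE|_].
      have et := subsetP E1t _ eE; rewrite et.
      by have := et; rewrite inE => /andP[-> _]; rewrite p_ge0 lexx.
    by rewrite !if_same ler01 lexx.
(* The sum over [E1] is (1 + p) ^ #|touch U|, at most exp (p n #|U|), which the first term of the
   deviation cancels. The term [L] pays for [A], and [2 * n] for the 2 ^ n sets [U], with exp (- n)
   left over. *)
apply: (@le_trans _ _ (\sum_(U : {set V}) \sum_(a : A)
   expR (- (p * n%:R * #|U|%:R + 2 * n%:R + L)) * expR (p * (#|U|%:R * n%:R)))).
  apply: ler_sum => U _; rewrite bern_mean_sum; apply: ler_sum => a _.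
  rewrite bern_mean_sum; apply: (le_trans (ler_sum _ (@bound U a))).
  rewrite -mulr_sumr sum_powerset_prod ler_wpM2l ?(ltW (expR_gt0 _)) //.
  rewrite prodr_const -natrM.
  apply: (@le_trans _ _ (expR p ^+ #|touch U|)).
    by rewrite addrC lerXn2r ?nnegrE ?expR_ge0 ?expR_ge1Dx // addr_ge0.
  rewrite -expRM_natr ler_expR ler_wpM2l // ler_nat.
  by rewrite (leq_trans (card_touch U)) // card_ord.
apply: (@le_trans _ _ (\sum_(U : {set V}) expR (- (2 * n%:R)))).
  apply: ler_sum => U _; rewrite sumr_const -expRD -[leLHS]mulr_natl.
  apply: (@le_trans _ _ (expR L * expR (- (p * n%:R * #|U|%:R + 2 * n%:R + L) +
      p * (#|U|%:R * n%:R)))).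
    by rewrite ler_wpM2r ?expR_ge0.
  rewrite -expRD ler_expR le_eqVlt; apply/orP; left; apply/eqP; ring.
rewrite sumr_const -[leLHS]mulr_natl -cardsT -powersetT card_powerset cardsT card_ord natrX.
have : (2 : R) ^+ n <= expR n%:R.
  rewrite -[n%:R]mul1r expRM_natr lerXn2r ?nnegrE ?expR_ge0 //.
  by have := expR_ge1Dx (1 : R); lra.
move=> /(ler_wpM2r (ltW (expR_gt0 (- (2 * n%:R)))))/le_trans -> //.
by rewrite -expRD ler_expR; lra.
Qed.

End UpperTails.

(** * Properties that the random graph has with high probability *)

Section TypicalGraphs.
Variables (R : realType) (n : nat) (p eps : R).
Hypotheses (p_ge0 : 0 <= p) (p_le1 : p <= 1) (eps_gt0 : 0 < eps) (eps_le1 : eps <= 1).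
Local Notation V := 'I_n.
Local Notation graph := {set {set V}}.

Lemma adj_touch (H : graph) (U : {set V}) u z : H \subset pairs V -> u \in U ->
  adj (H :&: touch U) u z = adj H u z.
Proof.
move=> /subsetP HV uU; rewrite /adj inE andb_idr // => /HV eV.
rewrite inE eV -setI_eq0; apply/set0Pn; exists u.
by rewrite inE uU !inE eqxx.
Qed.

Lemma via_touch (H : graph) (U : {set V}) z : H \subset pairs V ->
  via (adj (H :&: touch U)) U z = via (adj H) U z.
Proof.
move=> HV; apply/setP => y; apply/viaP/viaP => -[u uU];
  by rewrite ?adj_touch // => hu; exists u; rewrite ?adj_touch.
Qed.

Lemma off_sum (U Q : {set V}) (S : V -> {set V}) (F : V -> {set V} -> nat) :
  (forall v, F v set0 = 0%N) ->
  (\sum_v F v (off U (fun v => if v \in Q then S v else set0) v) =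
   \sum_(v in Q :\: U) F v (S v :\: U))%N.
Proof.
move=> F0; rewrite [RHS]big_mkcond; apply: eq_bigr => v _; rewrite /off in_setD.
by case: (v \in U); case: (v \in Q); rewrite ?set0D ?F0.
Qed.

Lemma supp_off (U Q : {set V}) (S : V -> {set V}) :
  supp (off U (fun v => if v \in Q then S v else set0)) \subset Q.
Proof.
apply/subsetP => v; rewrite inE /off; case: (v \in U); rewrite ?eqxx //.
by case: (v \in Q) => //; rewrite set0D eqxx.
Qed.

Lemma rdeg_set0 (r : rel V) v : rdeg r v set0 = 0%N.
Proof. by apply: rdeg0 => y; rewrite inE. Qed.

(** The family sees [H] only through its edges at [U], as [dependent_upper_tail] requires; making it
    empty outside [Q a] bounds its support by [#|Q a|]. *)
Lemma typical_family (A : finType) (L : R) (Q : A -> {set V})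
    (S : {set V} -> graph -> A -> V -> {set V}) :
  (forall (U : {set V}) (H : graph) a v, H \subset pairs V -> S U (H :&: touch U) a v = S U H a v) ->
  #|A|%:R <= expR L ->
  gnp_prob p (fun G : graph => ~ forall (U : {set V}) (a : A) (H : graph), H \subset G ->
    (\sum_(v in Q a :\: U) rdeg (adj G) v (S U H a v :\: U))%:R <=
    p * (\sum_(v in Q a :\: U) #|S U H a v :\: U|)%:R + eps * p * n%:R * #|Q a|%:R
       + 8 / eps * (p * n%:R * #|U|%:R + 2 * n%:R + L)) <= expR (- n%:R).
Proof.
move=> ST AL.
pose T U E1 (a : A) v := if v \in Q a then S U E1 a v else set0.
apply: le_trans (dependent_upper_tail p_ge0 p_le1 T eps_gt0 eps_le1 AL).
apply: gnp_prob_mono => // G GV nG; apply: contrapT => nB; apply: nG => U a H HG.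
rewrite leNgt; apply/negP => lt; apply: nB; exists U, a, H; split=> //.
have HV := subset_trans HG GV.
rewrite /arcs /T (off_sum _ _ _ (F := fun v B => rdeg (adj G) v B)); last first.
  by move=> v; rewrite rdeg_set0.
rewrite (off_sum _ _ _ (F := fun v B => #|B|)) => [|v]; last by rewrite cards0.
have e (F : V -> {set V} -> nat) : (\sum_(v in Q a :\: U) F v (S U (H :&: touch U) a v :\: U) =
    \sum_(v in Q a :\: U) F v (S U H a v :\: U))%N.
  by apply: eq_bigr => v _; rewrite ST.
rewrite (e (fun v B => rdeg (adj G) v B)) (e (fun v B => #|B|)).
apply: le_lt_trans lt; rewrite !lerD2r lerD2l ler_wpM2l ?mulr_ge0 ?(ltW eps_gt0) //.
by rewrite ler_nat subset_leq_card // supp_off.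
Qed.

(** There are 4 ^ n <= exp (2 n) choices of [(Q, Y)], so L = 2 n, and 8 / eps times 2 n + L is the
    source of 32 / eps. *)
Lemma whp_via_regular : (0 < n)%N ->
  gnp_prob p (fun G : graph => ~ forall H : graph, H \subset G ->
    via_regular (adj G) (adj H) p eps (32 / eps)) <= expR (- n%:R).
Proof.
move=> n0.
pose S U (H : graph) (a : {set V} * {set V}) v := a.2 :\: via (adj H) U v.
have AL : #|{: {set V} * {set V}}|%:R <= expR (2 * n%:R) :> R.
  rewrite card_prod -!cardsT -powersetT card_powerset cardsT card_ord -expnD addnn -mul2n.
  rewrite natrX -natrM -[(2 * n)%:R]mul1r expRM_natr lerXn2r ?nnegrE ?expR_ge0 //.
  by have := expR_ge1Dx (1 : R); lra.
apply: le_trans (@typical_family _ (2 * n%:R) fst S _ AL); last first.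
  by move=> U H a v HV; rewrite /S via_touch.
apply: gnp_prob_mono => // G GV nG M; apply: nG => H HG U Q Y.
have := M U (Q, Y) H HG; rewrite /= /S card_ord => /le_trans; apply.
rewrite -[eps * p * _]mulrA lerD2l -subr_ge0.
rewrite [X in 0 <= X](_ : _ = 24 / eps * (p * n%:R * #|U|%:R)); last first.
  by field; rewrite gt_eqF.
by rewrite !mulr_ge0 // ltW // invr_gt0.
Qed.

Definition descr : finType := (option bool * V)%type.

(** Per vertex there are 2 * (3 n) ^ 2 = 18 n ^ 2 choices: membership in [Q] and two descriptors. *)
Lemma whp_regions (l L : R) : (18 * n ^ 2)%:R ^+ n <= expR L ->
  gnp_prob p (fun G : graph => ~ forall (U Q : {set V}) (f : V -> descr * descr) (H : graph),
    H \subset G ->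
    (\sum_(v in Q :\: U) rdeg (adj G) v
      ((region (adj H) U l (f v).1 :&: region (adj H) U l (f v).2) :\: U))%:R <=
    p * (\sum_(v in Q :\: U)
      #|(region (adj H) U l (f v).1 :&: region (adj H) U l (f v).2) :\: U|)%:R
    + eps * p * n%:R * #|Q|%:R + 8 / eps * (p * n%:R * #|U|%:R + 2 * n%:R + L))
  <= expR (- n%:R).
Proof.
move=> AL.
pose A : finType := ({set V} * {ffun V -> descr * descr})%type.
pose S U (H : graph) (a : A) v :=
  region (adj H) U l (a.2 v).1 :&: region (adj H) U l (a.2 v).2.
have AL' : #|A|%:R <= expR L.
  apply: le_trans AL; rewrite -natrX ler_nat /A card_prod card_ffun !card_prod.
  rewrite card_option card_bool -cardsT -powersetT card_powerset cardsT card_ord.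
  by rewrite -expnMn; apply: eq_leq; congr (_ ^ _)%N; rewrite expnS expn1; ring.
have regE U (H : graph) d : H \subset pairs V ->
    region (adj (H :&: touch U)) U l d = region (adj H) U l d.
  move=> HV; have e z : sec (adj (H :&: touch U)) U z = sec (adj H) U z.
    by rewrite /sec via_touch.
  case: d => [[[]|] z] /=; rewrite ?e //.
  by apply/setP => y; rewrite !inE !e.
apply: le_trans (@typical_family _ L fst S _ AL'); last first.
  by move=> U H a v HV; rewrite /S !regE.
apply: gnp_prob_mono => // G GV nG M; apply: nG => U Q f H HG.
have := M U (Q, [ffun v => f v]) H HG; rewrite /= /S /=.
by under eq_bigr do rewrite ffunE; under [in X in _ <= X]eq_bigr do rewrite ffunE.
Qed.

(** Chernoff bound with parameter gamma / 2, from [expR_moment] with full targets and no prescribed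
    edges. *)
Lemma whp_edges (gamma : R) : 0 < gamma -> gamma <= 1 / 2 ->
  gnp_prob p (fun G : graph => (1 + 4 * gamma) * p * n%:R ^+ 2 < (2 * #|G|)%:R) <=
  expR (- (gamma ^+ 2 * (p * n%:R ^+ 2))).
Proof.
move=> g0 g1; pose l := gamma / 2.
have l0 : 0 <= l by rewrite /l; lra.
have l1 : l <= 1 / 4 by rewrite /l; lra.
pose T := fun _ : V => [set: V].
have hits0 e : e \in (set0 : graph) -> hits T e = 0%N by rewrite inE.
have mom : bern_mean p (pairs V) (fun G => (set0 \subset G)%:R * expR (l * (arcs T G)%:R)) <=
    expR (p * (l + 4 * l ^+ 2) * n%:R ^+ 2).
  apply: le_trans (expR_moment p_ge0 p_le1 l0 l1 (sub0set _) hits0) _.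
  rewrite big1 => [|e _]; last by rewrite inE.
  rewrite mul1r ler_expR (eq_bigr (fun=> n)) => [|v _]; last by rewrite cardsT card_ord.
  by rewrite sum_nat_const card_ord natrM -expr2.
pose f (G : graph) := expR (- (l * ((1 + 4 * gamma) * p * n%:R ^+ 2))) *
  ((set0 \subset G)%:R * expR (l * (arcs T G)%:R)).
apply: le_trans (gnp_prob_le (f := f) p_ge0 p_le1 _ _) _.
- by move=> G _; rewrite !mulr_ge0 ?expR_ge0 ?ler0n.
- move=> G GV lt; rewrite /f sub0set mul1r -expRD -[leLHS]expR0 ler_expR.
  rewrite /arcs handshake // addrC subr_ge0 ler_wpM2l // ltW //.
rewrite bern_meanZ; apply: le_trans (ler_wpM2l (expR_ge0 _) mom) _.
rewrite -expRD ler_expR /l.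
have k : 0 <= p * n%:R ^+ 2 by rewrite mulr_ge0 // sqr_ge0.
have : 0 <= gamma ^+ 2 * (p * n%:R ^+ 2) by rewrite mulr_ge0 // sqr_ge0.
lra.
Qed.

Lemma few_edges_markov : (0 < n)%N ->
  gnp_prob p (fun G : graph => (n <= 2 * #|G|)%N) <= p * n%:R.
Proof.
move=> n0; have n0' : 0 < n%:R :> R by rewrite ltr0n.
apply: le_trans (gnp_prob_le (f := fun G => 2 / n%:R * #|G :&: pairs V|%:R) p_ge0 p_le1 _ _) _.
- by move=> G _; rewrite mulr_ge0 // divr_ge0 // ltW.
- move=> G GV nG; rewrite (setIidPl GV) mulrAC ler_pdivlMr // mul1r.
  by rewrite -natrM ler_nat.
rewrite bern_meanZ bern_mean_card //.
have : (2 * #|pairs V| <= n * n)%N.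
  rewrite -handshake // -[X in (_ <= X * _)%N]card_ord -sum_nat_const leq_sum // => v _.
  by rewrite -[leqRHS]card_ord max_card.
rewrite -(ler_nat R) !natrM => c2.
rewrite -(ler_pM2r n0') -[leRHS]mulrA.
have -> : 2 / n%:R * (p * #|pairs V|%:R) * n%:R = p * (2 * #|pairs V|%:R).
  by field; rewrite gt_eqF.
exact: ler_wpM2l.
Qed.

End TypicalGraphs.

(** * The regime of large p ^ 2 n *)

Section DenseRegime.
Variables (R : realType) (V : finType) (g h : rel V) (p eps C q d th eta c kap : R) (w : nat).
Local Notation n := (#|V|%:R : R).
Local Notation D := (p * n).
Local Notation h0 := (2 / 5 + 8 * th).
Local Notation l := (h0 - 4 * th).
Hypotheses (p_gt0 : 0 < p) (p_le1 : p <= 1) (n_gt0 : 0 < n) (C_ge0 : 0 <= C).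
Hypotheses (hsym : symmetric h) (hg : forall x y, h x y -> g x y).
Hypothesis tri : forall x y z, h x y -> h y z -> h x z -> False.
Hypothesis hdeg : forall x, h0 * D <= (rdeg h x setT)%:R.
Hypothesis Mg : via_regular g h p eps C.
Hypothesis Mregion : forall (U Q : {set V})
    (f : V -> (option bool * V) * (option bool * V)),
  (\sum_(v in Q :\: U) rdeg g v ((region h U l (f v).1 :&: region h U l (f v).2) :\: U))%:R <=
  p * (\sum_(v in Q :\: U) #|(region h U l (f v).1 :&: region h U l (f v).2) :\: U|)%:R
  + eps * p * n * #|Q|%:R + 8 / eps * (p * n * #|U|%:R + kap).
Hypotheses (th_gt0 : 0 < th) (th_le : th <= 1 / 80).
Hypotheses (eta_gt0 : 0 < eta) (eta_le : 800 * eta <= th ^+ 3).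
Hypotheses (eps_gt0 : 0 < eps) (eps_le : eps <= th * eta).
Hypotheses (c_gt0 : 0 < c) (c_le : 32 * c <= eps * th * eta).
Hypotheses (kap_le : 32 * kap <= eps * th * eta * (D * n)).
Hypotheses (w_gt0 : (0 < w)%N) (w_le : w%:R <= (th * eta) ^+ 2 * c * n).
Hypotheses (w_ge1 : 2 * C * n ^+ 2 <= th * eta * D ^+ 2 * w%:R).
Hypotheses (w_ge2 : C * n <= D * w%:R).
Hypotheses (C_le1 : C <= th / 4 * eta * D) (C_le2 : C * n <= th / 20 * D ^+ 2).
Hypotheses (q_gt0 : 0 < q) (q_le : q <= 1 / 8).
Hypotheses (Cq : 8 * C * q <= eps) (qd : 28 <= q * d) (Cd : 4 * C <= eps * p * (q * d)).

Let D_gt0 : 0 < D. Proof. exact: mulr_gt0. Qed.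
Let Jg : upper_regular g p eps C := via_regular_upper Mg.
Let th3 : th ^+ 3 <= th ^+ 2 / 80.
Proof.
have t0 := th_gt0; have t1 := th_le.
by rewrite exprS mulrC ler_wpM2l ?sqr_ge0 //; lra.
Qed.
Let th2 : th ^+ 2 <= th / 80.
Proof. by have t0 := th_gt0; have t1 := th_le; rewrite expr2 ler_wpM2l ?(ltW t0) //; lra. Qed.
Let eta_le1 : 800 * eta <= 1.
Proof.
have t1 := th2; have t2 := th3; have t3 := eta_le; have t4 := th_le; lra.
Qed.
Let eps_le_th : eps <= th / 8.
Proof.
have e1 := eta_le1; have := ler_wpM2l (ltW th_gt0) e1.
have := eps_le; have := th_gt0; lra.
Qed.

(** With two witnessing descriptors chosen for each atypical vertex, [Mregion] is exceeded by
    [th * D] per vertex; half of this covers the [eps] term, and the rest must fit into the other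
    errors. *)
Lemma few_atypical_vertices (U : {set V}) : #|U|%:R <= c * n ->
  #|atypical_degree g h p th h0 U|%:R <= eta * n.
Proof.
move=> Us; set Q := atypical_degree _ _ _ _ _ _.
have [e0 n0 t0] := And3 eps_gt0 n_gt0 th_gt0; have et := eps_le_th.
have [f hf] : exists f : V -> (option bool * V) * (option bool * V), forall v, v \in Q ->
    p * #|region h U l (f v).1 :&: region h U l (f v).2|%:R + th * D <
    (rdeg g v ((region h U l (f v).1 :&: region h U l (f v).2) :\: U))%:R.
  apply: (@fin_all_exists _ (fun=> ((option bool * V) * (option bool * V))%type)
    (fun v a => v \in Q -> p * #|region h U l a.1 :&: region h U l a.2|%:R + th * D <
    (rdeg g v ((region h U l a.1 :&: region h U l a.2) :\: U))%:R)) => v.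
  have [|nQ] := boolP (v \in Q); last by exists ((None, v), (None, v)).
  by rewrite inE => /andP[_ /existsP[d1 /existsP[d2 lt]]]; exists (d1, d2).
have QU : Q :\: U = Q.
  by apply/setP => v; rewrite in_setD andb_idl // inE => /andP[].
have := Mregion U Q f; rewrite QU.
set S := (\sum_(v in Q) rdeg _ _ _)%N; set T := (\sum_(v in Q) _)%N => M.
have lo : p * T%:R + #|Q|%:R * (th * D) <= S%:R.
  have -> : #|Q|%:R * (th * D) = \sum_(v in Q) (th * D) by rewrite sumr_const mulr_natl.
  rewrite /S /T !natr_sum mulr_sumr -big_split /=.
  apply: ler_sum => v /hf /ltW; apply: le_trans; rewrite lerD2r ler_wpM2l ?(ltW p_gt0) //.
  by rewrite ler_nat subset_leq_card // subsetDl.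
have Dn : 0 < D * n := mulr_gt0 D_gt0 n0.
have h1 : 8 / eps * (p * n * #|U|%:R) <= th * eta / 4 * (D * n).
  rewrite mulrAC ler_pdivrMr //.
  have a1 := ler_wpM2l (ltW D_gt0) Us.
  by have := ler_wpM2r (ltW Dn) c_le; lra.
have h2 : 8 / eps * kap <= th * eta / 4 * (D * n).
  by rewrite mulrAC ler_pdivrMr //; have := kap_le; lra.
have h3 : eps * p * n * #|Q|%:R <= th / 2 * (D * #|Q|%:R).
  have k : 0 <= D * #|Q|%:R by rewrite mulr_ge0 // ltW.
  have e2 : eps <= th / 2 by lra.
  by have := ler_wpM2r k e2; lra.
have k : 0 < th / 2 * D by rewrite mulr_gt0 //; lra.
rewrite -(ler_pM2l k); move: M; rewrite [8 / eps * (_ + kap)]mulrDr; lra.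
Qed.

Lemma dense_nearly_bipartite : exists X : {set V},
  (inside h X)%:R <= th ^+ 2 / 4 * (D * n).
Proof.
have [t0 e0 t1] := And3 th_gt0 eta_gt0 th_le.
have [e1 e2 e3] := And3 eta_le eta_le1 eps_le_th; have a2 := th2; have a3 := th3.
have [U [Us satU]] := exists_saturating h c_gt0.
have te : 0 < th * eta by rewrite mulr_gt0.
have c_eta : c <= eta.
  have t2 : eps * th * eta <= 1 * eta.
    by rewrite ler_wpM2r ?(ltW e0) //; have := ler_wpM2r (ltW t0) e3; lra.
  have := c_le; lra.
have f1 : 100 * eta <= th ^+ 2 by have := sqr_ge0 th; lra.
have f2 : 2 < 5 * l by lra.
have f3 : th <= 1 by lra.
have f4 : eps <= th / 4 by lra.
have [X HX] := nearly_bipartite p_gt0 p_le1 n_gt0 C_ge0 Jg hsym hg tri hdeg t0 e0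
  f1 f2 f3 f4 eps_le c_gt0 c_eta Us satU w_gt0 w_le w_ge1 w_ge2
  C_le1 C_le2 (few_atypical_vertices Us).
exists X; apply: (le_trans HX); rewrite ler_wpM2r ?(ltW (mulr_gt0 D_gt0 n_gt0)) //.
rewrite ler_pdivrMr //; move: e1; rewrite exprSr; lra.
Qed.

Let th_quarter : th ^+ 2 / 4 <= th / 20.
Proof. by have := th2; have := th_gt0; lra. Qed.

(** Almost all of the degree [h0 * D] leaves [A] on average, and upper regularity limits what a
    small complement can receive. *)
Lemma large_complement (A : {set V}) :
  (inside h A)%:R <= th ^+ 2 / 4 * (D * n) -> n / 5 <= #|A|%:R ->
  (h0 - th) * n <= #|~: A|%:R.
Proof.
move=> Az A5.
have A0 : 0 < #|A|%:R :> R.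
  by apply: lt_le_trans A5; have := n_gt0; lra.
have Dn0 : 0 < D * n := mulr_gt0 D_gt0 n_gt0.
have DA0 : 0 < D * #|A|%:R := mulr_gt0 D_gt0 A0.
have DA : D * n <= 5 * (D * #|A|%:R).
  by have := ler_wpM2l (ltW D_gt0) A5; lra.
have b1 : (ec h A A)%:R <= th / 4 * (D * #|A|%:R).
  have z1 := ler_wpM2r (ltW Dn0) th_quarter.
  have z2 := ler_wpM2l (ltW th_gt0) DA.
  have z3 : (ec h A A)%:R <= (inside h A)%:R :> R by rewrite ler_nat leq_addr.
  by lra.
have b2 : C * n <= th / 4 * (D * #|A|%:R).
  have z := ler_wpM2r (ltW n_gt0) C_le1.
  have z1 : th * eta <= th * (1 / 800).
    by rewrite ler_wpM2l ?(ltW th_gt0) //; have := eta_le1; lra.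
  have z2 := ler_wpM2r (ltW Dn0) z1; have z3 := ler_wpM2l (ltW th_gt0) DA.
  by have := mulr_gt0 th_gt0 DA0; lra.
have b3 : eps * D * #|A|%:R <= th / 8 * (D * #|A|%:R).
  by rewrite -mulrA ler_wpM2r ?(ltW DA0).
have b4 := mulr_gt0 th_gt0 DA0.
have lo := ec_ge (fun x (_ : x \in A) => hdeg x).
have split : ec h A setT = (ec h A A + ec h A (~: A))%N.
  by rewrite /ec -big_split; apply: eq_bigr => x _; apply: rdegC.
have J := Jg A (~: A).
have gh : (ec h A (~: A))%:R <= (ec g A (~: A))%:R :> R by rewrite ler_nat ec_le.
rewrite split natrD in lo.
have k : 0 < p * #|A|%:R by rewrite mulr_gt0.
by rewrite -(ler_pM2l k); lra.
Qed.

Lemma dense_max_cut (X : {set V}) :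
  (forall Y, (inside h X <= inside h Y)%N) ->
  (forall x, x \in X -> (rdeg h x X <= rdeg h x (~: X))%N) ->
  (forall x, x \notin X -> (rdeg h x (~: X) <= rdeg h x X)%N) ->
  (inside h X)%:R <= 2 * (6 * d + 2 * C) * n.
Proof.
move=> minX halfX halfXC.
have Xz : (inside h X)%:R <= th ^+ 2 / 4 * (D * n).
  have [Y HY] := dense_nearly_bipartite.
  by apply: le_trans HY; rewrite ler_nat.
have XCz : (inside h (~: X))%:R <= th ^+ 2 / 4 * (D * n) by rewrite insideC.
have cC : #|X|%:R + #|~: X|%:R = n by rewrite -natrD cardsC.
have h0_big : 1 / 5 <= h0 - th by have := th_gt0; lra.
have hb := ler_wpM2r (ltW n_gt0) h0_big.
have [sX sXC] : (h0 - th) * n <= #|X|%:R /\ (h0 - th) * n <= #|~: X|%:R.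
  have [X5|X5] := leP (n / 5) #|X|%:R.
    have s1 := large_complement Xz X5; split=> //.
    rewrite -[X]setCK; apply: large_complement; rewrite ?setCK //.
    by lra.
  have XC5 : n / 5 <= #|~: X|%:R by have := n_gt0; lra.
  have := large_complement XCz XC5; rewrite setCK => s1.
  by lra.
have zz : 4 * (th ^+ 2 / 4) <= th ^+ 2 by lra.
have l2 : 2 < 5 * (h0 - 4 * th) by have := th_gt0; lra.
have eps4 : eps <= th / 4 by have := eps_le_th; have := th_gt0; lra.
have side A := @few_edges_inside R V g h p eps C q d p_gt0 n_gt0 C_ge0 hsym hg tri
  Mg eps_gt0 q_gt0 q_le Cq qd Cd th (th ^+ 2 / 4) h0 th_gt0 l2 eps4 zz hdeg A.
have i1 : (ec h X X)%:R <= (6 * d + 2 * C) * n.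
  apply: side => //; last by lra.
  by apply: le_trans Xz; rewrite ler_nat leq_addr.
have i2 : (ec h (~: X) (~: X))%:R <= (6 * d + 2 * C) * n.
  apply: side; rewrite ?setCK; last by lra.
    by move=> x; rewrite inE; apply: halfXC.
  by apply: le_trans XCz; rewrite ler_nat leq_addr.
by rewrite /inside natrD; lra.
Qed.

End DenseRegime.

(** * Proof of the theorem *)

Section Cuts.
Variable V : finType.
Implicit Types (H : {set {set V}}) (X : {set V}).

Definition inner_edges H X : {set {set V}} :=
  [set e in H | (e \subset X) || (e \subset ~: X)].

Lemma adj_inner H X x y :
  adj (inner_edges H X) x y = adj H x y && ((x \in X) == (y \in X)).
Proof.
rewrite /adj inE !subUset !sub1set !inE.
by case: (x \in X); case: (y \in X).
Qed.

Lemma card_inner_edges H X : H \subset pairs V ->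
  (2 * #|inner_edges H X| = inside (adj H) X)%N.
Proof.
move=> HV; have FH : inner_edges H X \subset H.
  by apply/subsetP => e; rewrite inE => /andP[].
rewrite -handshake ?(subset_trans FH) // (bigID (mem X)) /=; congr (_ + _)%N.
  apply: eq_bigr => x xX; congr #|pred_of_set _|; apply/setP => y.
  by rewrite !inE adj_inner xX; case: (y \in X); rewrite /= ?andbT ?andbF.
apply: eq_big => x; rewrite ?inE // => xX; congr #|pred_of_set _|; apply/setP => y.
by rewrite !inE adj_inner (negbTE xX); case: (y \in X); rewrite /= ?andbT ?andbF.
Qed.

Lemma bipartite_inner_edges H X : bipartite (H :\: inner_edges H X).
Proof.
exists X => u v; rewrite /adj in_setD => /andP[nF uvH].
have := adj_inner H X u v; rewrite /adj uvH (negbTE nF) /=.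
by case: (_ == _).
Qed.

Lemma min_degree_le H x : (min_degree H <= rdeg (adj H) x setT)%N.
Proof.
have -> : rdeg (adj H) x setT = degree H x.
  by congr #|pred_of_set _|; apply/setP => y; rewrite !inE.
by rewrite /min_degree -minEnat -leEnat; apply: bigmin_le.
Qed.

End Cuts.

Section Goodness.
Variables (R : realType) (gamma C : R).

Definition good (n : nat) (p : R) (G : {set {set 'I_n}}) : Prop :=
  forall H : {set {set 'I_n}},
    H \subset G -> triangle_free H ->
    (2 / 5 + gamma) * p * n%:R <= (min_degree H)%:R ->
    exists F : {set {set 'I_n}},
      [/\ F \subset H,
          #|F|%:R <= Num.min (C * p^-1 * n%:R) ((1 / 4 + gamma) * p * n%:R ^+ 2)
        & bipartite (H :\: F)].

(** Vacuous: with fewer than n / 2 edges some vertex is isolated, so no [H] has positive minimum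
    degree. *)
Lemma good_of_few_edges n p (G : {set {set 'I_n}}) :
  0 < gamma -> 0 < p -> (0 < n)%N -> G \subset pairs 'I_n ->
  ~ (n <= 2 * #|G|)%N -> good p G.
Proof.
move=> g0 p0 n0 GV nG H HG _ hdeg; exfalso; apply: nG.
have pos : (0 < min_degree H)%N.
  rewrite -(ltr_nat R); apply: lt_le_trans hdeg.
  by rewrite !mulr_gt0 ?ltr0n // addr_gt0.
have HV := subset_trans HG GV.
apply: (@leq_trans (2 * #|H|)); last by rewrite leq_mul2l subset_leq_card.
rewrite -handshake // -[leqLHS]card_ord -sum1_card leq_sum // => x _.
exact: leq_trans pos (min_degree_le H x).
Qed.

(** The inner edges of a maximum cut serve as [F]. Each vertex has at most half of its degree inside
    its own side, which gives the second bound of the minimum; the first is left to [bound]. *)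
Lemma good_of_max_cut n p gamma' (G : {set {set 'I_n}}) :
  gamma' <= gamma -> 0 < p -> (0 < n)%N -> G \subset pairs 'I_n ->
  (2 * #|G|)%:R <= (1 + 4 * gamma') * p * n%:R ^+ 2 ->
  (forall (H : {set {set 'I_n}}) (X : {set 'I_n}), H \subset G -> triangle_free H ->
    (2 / 5 + gamma) * p * n%:R <= (min_degree H)%:R ->
    (forall Y, (inside (adj H) X <= inside (adj H) Y)%N) ->
    (forall x, x \in X -> (rdeg (adj H) x X <= rdeg (adj H) x (~: X))%N) ->
    (forall x, x \notin X -> (rdeg (adj H) x (~: X) <= rdeg (adj H) x X)%N) ->
    #|inner_edges H X|%:R <= (1 / 4 + gamma) * p * n%:R ^+ 2 ->
    #|inner_edges H X|%:R <= C * p^-1 * n%:R) ->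
  good p G.
Proof.
move=> gg p0 n0 GV Gs bound H HG tf hdeg.
have HV := subset_trans HG GV.
have hirr : irreflexive (adj H).
  by move=> x; apply/negP => /(adj_neq HV); rewrite eqxx.
have [X [minX [hX hXC]]] := exists_max_cut (adj_sym H) hirr.
have cF := card_inner_edges X HV.
have Fb : #|inner_edges H X|%:R <= (1 / 4 + gamma) * p * n%:R ^+ 2.
  have : (4 * #|inner_edges H X| <= 2 * #|G|)%N.
    apply: (@leq_trans (2 * #|H|)); last by rewrite leq_mul2l subset_leq_card.
    rewrite -[4%N]/(2 * 2)%N -mulnA cF -handshake // /inside /ec.
    rewrite [leqRHS](bigID (mem X)) /= mulnDr !big_distrr /=; apply: leq_add.
      apply: leq_sum => x xX; rewrite (rdegC _ x X) mul2n -addnn leq_add2l.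
      exact: hX.
    rewrite [leqLHS](eq_bigl (fun x => x \notin X)) => [|x]; last by rewrite inE.
    apply: leq_sum => x xX; rewrite (rdegC _ x X) mul2n -addnn leq_add2r.
    exact: hXC.
  rewrite -(ler_nat R) natrM => h1.
  have k : 0 < p * n%:R ^+ 2 by rewrite mulr_gt0 ?exprn_gt0 ?ltr0n.
  have := ler_wpM2r (ltW k) gg; lra.
exists (inner_edges H X); split.
- by apply/subsetP => e; rewrite inE => /andP[].
- by rewrite le_min Fb andbT; apply: bound.
- exact: bipartite_inner_edges.
Qed.

End Goodness.

Lemma expRN_le_inv (R : realType) (x : R) : 0 < x -> expR (- x) <= x^-1.
Proof.
move=> x0; rewrite expRN lef_pV2 ?posrE ?expR_gt0 //.
by have := expR_ge1Dx x; lra.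
Qed.

Lemma exists_natr_ge (R : realType) (x : R) : exists N : nat, forall n, (N <= n)%N -> x <= n%:R.
Proof.
exists (Num.bound `|x|) => n Nn; apply: le_trans (ler_norm x) _.
by apply: le_trans (ltW (archi_boundP (normr_ge0 x))) _; rewrite ler_nat.
Qed.

Lemma exists_floor (R : realType) (x : R) : 2 <= x ->
  exists w : nat, [/\ (0 < w)%N, w%:R <= x & x <= 2 * w%:R].
Proof.
move=> x2; have x0 : 0 <= x by lra.
have /andP[h1 h2] := truncn_itv x0.
have h3 : x < (Num.truncn x)%:R + 1 by rewrite -natr1 in h2.
exists (Num.truncn x); split=> //; last by lra.
by rewrite -(ltr_nat R); lra.
Qed.

(* exp (kappa * D) beats every power of D >= sqrt n. *)
Lemma descriptors_le_expR (R : realType) (n : nat) (kappa D : R) :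
  0 < kappa -> (0 < n)%N -> 4 <= kappa * D -> n%:R <= D ^+ 2 ->
  18 * 720 * 64 / kappa ^+ 6 <= n%:R ->
  (18 * n ^ 2)%:R ^+ n <= expR (kappa * D * n%:R - 2 * n%:R).
Proof.
move=> k0 n0 kD D2 nk.
have n0' : 0 < n%:R :> R by rewrite ltr0n.
rewrite -mulrBl expRM_natr lerXn2r ?nnegrE ?expR_ge0 ?ler0n //.
pose x := kappa * D / 2.
apply: (@le_trans _ _ (expR x)); last by rewrite ler_expR /x; lra.
have x0 : 0 <= x by rewrite /x; lra.
(* The term of order 6 suffices: 720 is 6! and 64 is 2 ^ 6, from x = kappa D / 2. *)
have := expR_ge1Dxn 5 x0; rewrite (_ : 6`!%:R = 720) // => e1.
have k6 : 0 < kappa ^+ 6 by rewrite exprn_gt0.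
have x6 : x ^+ 6 = kappa ^+ 6 * (D ^+ 2) ^+ 3 / 64 by rewrite /x; field.
have D6 : n%:R ^+ 3 <= (D ^+ 2) ^+ 3 by rewrite lerXn2r ?nnegrE ?sqr_ge0 ?ler0n.
have h1 := ler_wpM2l (ltW k6) D6.
have h2 : 18 * 720 * 64 <= n%:R * kappa ^+ 6 by rewrite -ler_pdivrMr.
have h3 := ler_wpM2r (sqr_ge0 (n%:R : R)) h2.
rewrite natrM natrX; move: e1; rewrite x6.
have e3 : n%:R ^+ 3 = n%:R * n%:R ^+ 2 :> R by rewrite exprS.
rewrite e3 in h1; move=> e1; lra.
Qed.

(** * Choice of constants and the ranges of p *)

Section Constants.
Variables (R : realType) (gamma th eta eps C c om q d1 K Cf : R).
Hypotheses (th0 : 0 < th) (th1 : th <= 1 / 80) (thg : 8 * th <= gamma).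
Hypotheses (eta0 : 0 < eta) (etaE : 800 * eta = th ^+ 3).
Hypotheses (eps0 : 0 < eps) (eps1 : eps <= 1) (epsE : eps = th * eta).
Hypotheses (C0 : 0 < C) (CE : C = 32 / eps).
Hypotheses (c0 : 0 < c) (cE : 32 * c = eps * th * eta).
Hypotheses (om0 : 0 < om) (omE : 2 * om = (th * eta) ^+ 2 * c).
Hypotheses (q0 : 0 < q) (q1 : q <= 1 / 8) (Cq : 8 * C * q <= eps).
Hypotheses (d10 : 0 < d1) (qd1 : q * d1 = 28 + 4 * C / eps).
Hypotheses (K1 : 1 <= K) (Ka : 2 * C <= th * eta * om * K) (Kb : C <= th / 20 * K).
Hypothesis (CfE : Cf = 6 * d1 + 2 * C + (1 / 4 + gamma) * K).

Section FixedSize.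
Variables (n : nat) (p : R).
Local Notation D := (p * n%:R).
Hypotheses (n0 : (0 < n)%N) (p0 : 0 < p) (p1 : p <= 1) (Kp : K <= p ^+ 2 * n%:R).
Hypotheses (Dom : C <= om * D) (Deta : 4 * C <= th * eta * D) (Dc : 4 <= c * D).
Hypothesis (nom : 1 <= om * n%:R).
Local Notation l := (2 / 5 + 8 * th - 4 * th).
Local Notation kap := (c * D * n%:R).

Let n0' : 0 < n%:R :> R. Proof. by rewrite ltr0n. Qed.
Let D0 : 0 < D. Proof. exact: mulr_gt0. Qed.

Let KD : K * n%:R <= D ^+ 2.
Proof.
have -> : D ^+ 2 = p ^+ 2 * n%:R * n%:R by ring.
by rewrite ler_wpM2r // ltW.
Qed.

Lemma dense_good (G : {set {set 'I_n}}) : G \subset pairs 'I_n ->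
  (2 * #|G|)%:R <= (1 + 4 * (8 * th)) * p * n%:R ^+ 2 ->
  (forall H : {set {set 'I_n}}, H \subset G -> via_regular (adj G) (adj H) p eps C) ->
  (forall (U Q : {set 'I_n}) (f : 'I_n -> descr n * descr n) (H : {set {set 'I_n}}),
    H \subset G ->
    (\sum_(v in Q :\: U) rdeg (adj G) v
      ((region (adj H) U l (f v).1 :&: region (adj H) U l (f v).2) :\: U))%:R <=
    p * (\sum_(v in Q :\: U)
      #|(region (adj H) U l (f v).1 :&: region (adj H) U l (f v).2) :\: U|)%:R
    + eps * p * n%:R * #|Q|%:R + 8 / eps * (D * #|U|%:R + kap)) ->
  good gamma Cf p G.
Proof.
move=> GV Gs M2 M3.
have [w [w0 w1 w2]] : exists w : nat, [/\ (0 < w)%N, w%:R <= (th * eta) ^+ 2 * c * n%:R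
    & (th * eta) ^+ 2 * c * n%:R <= 2 * w%:R].
  by apply: exists_floor; rewrite -omE; have := nom; lra.
have wom : om * n%:R <= w%:R by move: w2; rewrite -omE; lra.
apply: (good_of_max_cut thg p0 n0 GV Gs) => H X HG tf hdeg minX hX hXC _.
have nE : #|'I_n|%:R = n%:R :> R by rewrite card_ord.
have te0 : 0 < th * eta by rewrite mulr_gt0.
(* The degree threshold is of order 1 / p, so that (6 d + 2 C) n is of order n / p. *)
have [d dE] : exists d : R, d * p = d1 by exists (d1 / p); rewrite divfK ?gt_eqF.
have dd1 : d1 <= d.
  rewrite -dE -[leRHS]mulr1 ler_wpM2l //.
  by rewrite -(pmulr_lge0 _ p0) dE ltW.
have bound : (inside (adj H) X)%:R <= 2 * (6 * d + 2 * C) * n%:R.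
  rewrite -nE.
  apply: (@dense_max_cut R _ (adj G) (adj H) p eps C q d th eta c kap w) => //;
    rewrite ?nE //.
  - exact: ltW.
  - exact: adj_sym.
  - by move=> x y; apply: (subsetP HG).
  - by move=> x y z xy yz xz; apply: (tf x y z).
  - move=> x; apply: (@le_trans _ _ (min_degree H)%:R); last by rewrite ler_nat min_degree_le.
    by apply: le_trans hdeg; rewrite -mulrA ler_wpM2r ?(ltW D0) // lerD2l.
  - exact: M2.
  - by move=> U Q f; apply: (M3 U Q f H HG).
  - by rewrite etaE.
  - by rewrite epsE.
  - by rewrite cE.
  - by rewrite -cE -!mulrA.
  - have a1 := ler_wpM2l (ltW te0) wom.
    have a2 := ler_wpM2r (sqr_ge0 D) a1.
    have a3 := ler_wpM2r (sqr_ge0 (n%:R : R)) Ka.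
    have k : 0 < th * eta * om * n%:R by rewrite mulr_gt0 // mulr_gt0.
    have a4 := ler_wpM2l (ltW k) KD.
    lra.
  - have a2 := ler_wpM2r (ltW n0') Dom.
    have := ler_wpM2l (ltW D0) wom; lra.
  - by have := Deta; lra.
  - have a1 := ler_wpM2r (ltW n0') Kb.
    have k : 0 < th / 20 by rewrite divr_gt0.
    by have := ler_wpM2l (ltW k) KD; lra.
  - apply: (@le_trans _ _ (q * d1)); last by rewrite ler_wpM2l // ltW.
    by rewrite qd1 lerDl ltW // divr_gt0 // mulr_gt0.
  - rewrite [leRHS](_ : _ = eps * (q * d1)); last by rewrite -dE; ring.
    rewrite qd1 mulrDr [eps * (_ / _)]mulrC divfK ?gt_eqF // lerDr.
    by rewrite mulr_ge0 // ltW.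
have HV := subset_trans HG GV.
move: bound; rewrite -card_inner_edges // natrM => bound.
have b1 : #|inner_edges H X|%:R <= (6 * d + 2 * C) * n%:R by lra.
apply: (le_trans b1); rewrite ler_wpM2r ?(ltW n0') // ler_pdivlMr //.
have b2 : C * p <= C * 1 by rewrite ler_wpM2l // ltW.
have b3 : 0 <= (1 / 4 + gamma) * K.
  have g0 : 0 <= 1 / 4 + gamma by have := thg; have := th0; lra.
  by rewrite mulr_ge0 // (le_trans ler01).
have b4 : 6 * (d * p) = 6 * d1 by rewrite dE.
by rewrite CfE; lra.
Qed.

Lemma whp_dense :
  18 * 720 * 64 / c ^+ 6 <= n%:R ->
  gnp_prob p (fun G => ~ @good R gamma Cf n p G) <=
  gnp_prob p (fun G : {set {set 'I_n}} =>
    (1 + 4 * (8 * th)) * p * n%:R ^+ 2 < (2 * #|G|)%:R) +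
  (expR (- n%:R) + expR (- n%:R)).
Proof.
(* Chosen so that [2 * n%:R + L] is [kap]. *)
move=> nc; have p0' := ltW p0; pose L := c * D * n%:R - 2 * n%:R.
have D2n : n%:R <= D ^+ 2.
  by apply: le_trans KD; rewrite -[leLHS]mul1r ler_wpM2r // ltW.
have HP2 := whp_via_regular p0' p1 eps0 eps1 n0; rewrite -CE in HP2.
have HP3 := whp_regions p0' p1 eps0 eps1 l (descriptors_le_expR c0 n0 Dc D2n nc).
apply: le_trans (lerD (lexx _) (lerD HP2 HP3)).
apply: le_trans (lerD (lexx _) (gnp_prob_or p0' p1 _ _)).
apply: le_trans (gnp_prob_or p0' p1 _ _).
apply: gnp_prob_mono => // G GV ng; apply: contrapT => nP; apply: ng.
apply: dense_good => //.
- by rewrite leNgt; apply/negP => lt; apply: nP; left.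
- by apply: contrapT => nM; apply: nP; right; left.
move=> U Q f H HG; have M := contrapT (fun nM => nP (or_intror (or_intror nM))).
have := M U Q f H HG; rewrite -[_ + 2 * n%:R + _]addrA [2 * n%:R + _]addrC subrK.
by [].
Qed.

(** As p ^ 2 n < K, the bound (1 / 4 + gamma) p n ^ 2 is itself at most (1 / 4 + gamma) K n / p. *)
Lemma sparse_good (G : {set {set 'I_n}}) : G \subset pairs 'I_n ->
  p ^+ 2 * n%:R < K -> (2 * #|G|)%:R <= (1 + 4 * (8 * th)) * p * n%:R ^+ 2 ->
  good gamma Cf p G.
Proof.
move=> GV pK Gs.
apply: (good_of_max_cut thg p0 n0 GV Gs) => H X _ _ _ _ _ _ Fb.
apply: (le_trans Fb); rewrite -(ler_pM2r p0).
have -> : Cf / p * n%:R * p = Cf * n%:R by rewrite mulrAC divfK ?gt_eqF.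
have g0 : 0 < 1 / 4 + gamma by have := thg; have := th0; lra.
have a1 := ler_wpM2l (ltW (mulr_gt0 g0 n0')) (ltW pK).
have a2 : (1 / 4 + gamma) * K * n%:R <= Cf * n%:R.
  by rewrite ler_wpM2r ?(ltW n0') // CfE; have := d10; have := C0; lra.
lra.
Qed.

End FixedSize.
End Constants.

(** With [D ^+ 2] at least n, every requirement y <= a D becomes a lower bound on n that does not
    involve p. *)
Lemma le_mul_of_sqr (R : realType) (a y m D : R) :
  0 < a -> 0 < D -> (y / a) ^+ 2 <= m -> m <= D ^+ 2 -> y <= a * D.
Proof.
move=> a0 D0 ym mD; rewrite [leRHS]mulrC -ler_pdivrMr // leNgt; apply/negP => lt.
have lt2 : D ^+ 2 < (y / a) ^+ 2.
  by rewrite ltr_pXn2r ?nnegrE ?(ltW D0) ?(ltW (lt_trans D0 lt)).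
by have := le_lt_trans (le_trans ym mD) lt2; rewrite ltxx.
Qed.

(** Each constant is determined by [gamma] and the constants listed before it; [K] comes last, as a
    sum of all that it must dominate. *)
Lemma exists_parameters (R : realType) (gamma : R) : 0 < gamma ->
  exists th eta eps C c om q d1 K : R,
  [/\ [/\ 0 < th, th <= 1 / 80, 8 * th <= gamma, 0 < eta & 800 * eta = th ^+ 3],
      [/\ 0 < eps, eps <= 1, eps = th * eta, 0 < C & C = 32 / eps],
      [/\ 0 < c, 32 * c = eps * th * eta, 0 < om & 2 * om = (th * eta) ^+ 2 * c],
      [/\ 0 < q, q <= 1 / 8, 8 * C * q <= eps, 0 < d1 & q * d1 = 28 + 4 * C / eps] &
      [/\ 1 <= K, 2 * C <= th * eta * om * K & C <= th / 20 * K]].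
Proof.
move=> gamma0.
have [th [th0 th1 thg]] : exists th : R, [/\ 0 < th, th <= 1 / 80 & 8 * th <= gamma].
  exists (Num.min (gamma / 8) (1 / 80)); split.
  - by rewrite lt_min; apply/andP; split; lra.
  - by rewrite ge_min lexx orbT.
  - have : Num.min (gamma / 8) (1 / 80) <= gamma / 8 by rewrite ge_min lexx.
    lra.
have [eta [eta0 etaE]] : exists eta : R, 0 < eta /\ 800 * eta = th ^+ 3.
  exists (th ^+ 3 / 800); split; last by lra.
  by have : 0 < th ^+ 3; [rewrite exprn_gt0 | lra].
have te0 : 0 < th * eta by rewrite mulr_gt0.
have te1 : th * eta <= 1.
  have z : eta <= 1.
    by have : th ^+ 3 <= 1; [rewrite exprn_ile1 //; lra | lra].
  by have := ler_wpM2l (ltW th0) z; lra.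
have [eps epsE] : exists eps : R, eps = th * eta by exists (th * eta).
have eps0 : 0 < eps by rewrite epsE.
have eps1 : eps <= 1 by rewrite epsE.
have [C CE] : exists C : R, C = 32 / eps by exists (32 / eps).
have C0 : 0 < C by rewrite CE divr_gt0 ?ltr0n.
have [c cE] : exists c : R, 32 * c = eps * th * eta by exists (eps * th * eta / 32); lra.
have c0 : 0 < c.
  have : 0 < eps * (th * eta) by rewrite mulr_gt0.
  lra.
have [om omE] : exists om : R, 2 * om = (th * eta) ^+ 2 * c.
  by exists ((th * eta) ^+ 2 * c / 2); lra.
have om0 : 0 < om.
  have : 0 < (th * eta) ^+ 2 * c by rewrite mulr_gt0 // exprn_gt0.
  lra.
have [q qE] : exists q : R, 256 * q = eps ^+ 2 by exists (eps ^+ 2 / 256); lra.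
have q0 : 0 < q by have : 0 < eps ^+ 2; [rewrite exprn_gt0 | lra].
have q1 : q <= 1 / 8.
  by have : eps ^+ 2 <= 1; [rewrite exprn_ile1 // ltW | lra].
have Cq : 8 * C * q <= eps.
  have Ce : C * eps = 32 by rewrite CE divfK // gt_eqF.
  have : C * (256 * q) = 32 * eps by rewrite qE expr2 mulrA Ce.
  lra.
have [d1 dE] : exists d1 : R, q * d1 = 28 + 4 * C / eps.
  by exists ((28 + 4 * C / eps) / q); rewrite mulrC divfK // gt_eqF.
have d0 : 0 < d1.
  rewrite -(pmulr_rgt0 _ q0) dE addr_gt0 ?ltr0n // divr_gt0 //.
  by rewrite mulr_gt0 ?ltr0n.
have teo0 : 0 < th * eta * om by rewrite mulr_gt0.
have a1 : 0 < 2 * C / (th * eta * om) by rewrite divr_gt0 // mulr_gt0 ?ltr0n.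
have a2 : 0 < 20 * C / th by rewrite divr_gt0 // mulr_gt0 ?ltr0n.
exists th, eta, eps, C, c, om, q, d1.
exists (2 * C / (th * eta * om) + 20 * C / th + 1).
have e1 : 2 * C <= th * eta * om * (2 * C / (th * eta * om) + 20 * C / th + 1).
  rewrite [leRHS]mulrC -ler_pdivrMr // -addrA lerDl addr_ge0 // ltW //.
have e2 : 20 * C <= th * (2 * C / (th * eta * om) + 20 * C / th + 1).
  rewrite [leRHS]mulrC -ler_pdivrMr // [2 * C / _ + _]addrC -addrA lerDl addr_ge0 // ltW //.
split; split=> //; last by lra.
by rewrite -[leLHS]add0r lerD // addr_ge0 // ltW.
Qed.

(** [N] is chosen before [p], so the bound holds along every function p(n). The ranges are p n <=
    delta, then p n > delta with p ^ 2 n below [K], and with p ^ 2 n at least [K]. *)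
Lemma whp_good (R : realType) (gamma : R) : 0 < gamma ->
  exists C : R, forall delta : R, 0 < delta -> exists N : nat, forall n : nat,
    (N <= n)%N -> forall p : R, 0 < p -> p <= 1 ->
    1 - delta <= gnp_prob p (@good R gamma C n p).
Proof.
move=> gamma0.
have [th [eta [eps [C [c [om [q [d1 [K [h1 h2 h3 h4 h5]]]]]]]]]] :=
  exists_parameters gamma0.
case: h1 h2 => th0 th1 thg eta0 etaE [eps0 eps1 epsE C0 CE].
case: h3 h4 h5 => c0 cE om0 omE [q0 q1 Cq d10 qd1] [K1 Ka Kb].
have [Cf CfE] : exists Cf : R, Cf = 6 * d1 + 2 * C + (1 / 4 + gamma) * K.
  by exists (6 * d1 + 2 * C + (1 / 4 + gamma) * K).
exists Cf => delta delta0.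
have te0 : 0 < th * eta by rewrite mulr_gt0.
have [N1 HN1] := exists_natr_ge ((C / om) ^+ 2).
have [N2 HN2] := exists_natr_ge ((4 * C / (th * eta)) ^+ 2).
have [N3 HN3] := exists_natr_ge ((4 / c) ^+ 2).
have [N4 HN4] := exists_natr_ge (1 / om).
have [N5 HN5] := exists_natr_ge (18 * 720 * 64 / c ^+ 6).
have [N6 HN6] := exists_natr_ge (3 / delta).
(* When p n > delta, this makes the exponent (8 th) ^ 2 p n ^ 2 of [whp_edges] at least 3 /
   delta. *)
have [N7 HN7] := exists_natr_ge (3 / delta / ((8 * th) ^+ 2 * delta)).
exists (maxn 1 (maxn N1 (maxn N2 (maxn N3 (maxn N4 (maxn N5 (maxn N6 N7))))))) => n.
rewrite !geq_max => /and5P[n0 /HN1 n1 /HN2 n2 /HN3 n3].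
move=> /and4P[/HN4 n4 /HN5 n5 /HN6 n6 /HN7 n7] p p0 p1.
have n0' : 0 < n%:R :> R by rewrite ltr0n.
have p0' := ltW p0.
rewrite gnp_probC // lerD2l lerN2.
have [pn|pn] := leP (p * n%:R) delta.
  apply: le_trans pn; apply: le_trans (few_edges_markov p0' p1 n0).
  apply: gnp_prob_mono => // G GV ng; apply: contrapT => nG; apply: ng.
  exact: good_of_few_edges.
have pn0 : 0 < p * n%:R by rewrite mulr_gt0.
have small (x : R) : 3 / delta <= x -> expR (- x) <= delta / 3.
  move=> xd; have d0 : 0 < 3 / delta by rewrite divr_gt0 ?ltr0n.
  have x0 : 0 < x by apply: lt_le_trans xd.
  apply: le_trans (expRN_le_inv x0) _.
  by rewrite -[leRHS]invrK lef_pV2 ?posrE ?invr_gt0 ?divr_gt0 ?ltr0n // invf_div.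
have t8 : 0 < 8 * th by rewrite mulr_gt0 ?ltr0n.
have t8' : 8 * th <= 1 / 2 by clear -th1; lra.
have HP1 : gnp_prob p (fun G : {set {set 'I_n}} =>
    (1 + 4 * (8 * th)) * p * n%:R ^+ 2 < (2 * #|G|)%:R) <= delta / 3.
  apply: le_trans (whp_edges n p0' p1 t8 t8') _.
  apply: small; move: n7; rewrite ler_pdivrMr ?mulr_gt0 ?exprn_gt0 // => n7.
  apply: (le_trans n7).
  rewrite mulrCA ler_wpM2l ?sqr_ge0 // expr2 mulrA mulrC.
  by rewrite ler_wpM2r ?(ltW n0') // ltW.
have [Kp|Kp] := ltP (p ^+ 2 * n%:R) K.
  apply: le_trans (le_trans HP1 _); last by clear -delta0; lra.
  apply: gnp_prob_mono => // G GV ng; rewrite ltNge; apply/negP => Gs; apply: ng.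
  exact: (sparse_good th0 thg C0 d10 CfE n0 p0 GV Kp Gs).
have D2n : n%:R <= (p * n%:R) ^+ 2.
  have -> : (p * n%:R) ^+ 2 = p ^+ 2 * n%:R * n%:R by clear; ring.
  by rewrite -[leLHS]mul1r ler_wpM2r ?(ltW n0') // (le_trans K1).
have Dom := le_mul_of_sqr om0 pn0 n1 D2n.
have Deta := le_mul_of_sqr te0 pn0 n2 D2n.
have Dc := le_mul_of_sqr c0 pn0 n3 D2n.
have nom : 1 <= om * n%:R by rewrite mulrC -ler_pdivrMr.
apply: (@le_trans _ _ (delta / 3 + (delta / 3 + delta / 3))); last by clear; lra.
apply: (le_trans _ (lerD HP1 (lerD (small _ n6) (small _ n6)))).
by apply: (@whp_dense R gamma th eta eps C c om q d1 K Cf).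
Qed.

Theorem theorem3 (R : realType) (gamma : R) (gamma_gt0 : 0 < gamma) :
  exists C : R, forall p : nat -> R,
    (forall n : nat, 0 < p n <= 1) ->
    aas p (fun (n : nat) (G : {set {set 'I_n}}) =>
      forall H : {set {set 'I_n}},
        H \subset G ->
        triangle_free H ->
        (2 / 5 + gamma) * p n * n%:R <= (min_degree H)%:R ->
        exists F : {set {set 'I_n}},
          [/\ F \subset H,
              #|F|%:R <= Num.min (C * (p n)^-1 * n%:R)
                                 ((1 / 4 + gamma) * p n * n%:R ^+ 2)
            & bipartite (H :\: F)]).
Proof.
have [C HC] := whp_good gamma_gt0; exists C => p p01.
apply/cvgrPdist_le => /= e e0; have [N HN] := HC e e0.
exists N => // n /= Nn; have /andP[p0 p1] := p01 n.
have := HN n Nn (p n) p0 p1; rewrite /good => h1.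
have h2 := gnp_prob_le1 (ltW p0) p1 (@good R gamma C n (p n)).
by rewrite ger0_norm ?subr_ge0 // lerBlDr addrC -lerBlDr.
Qed.
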